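(* Let $0<\alpha<1$. Let $\gamma\in C^2(\mathbb{R}^+)$ be a real-valued function that is monotonic on $\mathbb{R}^+$, with $\lim_{t\to0^+}\gamma(t)=\lim_{t\to0^+}\gamma'(t)=0$, with $\omega_{\infty,1}\ge\omega_{0,2}$ and $\omega_{0,1}>1$, and such that there exist positive constants $C^{(1)}_1,C^{(2)}_1,C^{(1)}_2$ with $$\left|\frac{t\gamma'(t)}{\gamma(t)}\right|\le C^{(1)}_2\quad\text{and}\quad \left|\frac{t^j\gamma^{(j)}(t)}{\gamma(t)}\right|\ge C^{(j)}_1\ \ (j=1,2)\qquad\text{for all } t\in\mathbb{R}^+ .$$ Assume moreover that $\frac{\alpha}{1-\alpha}\ge\omega_{\infty,1}$. Let $\left(\frac1p,\frac1q,\frac1r\right)$ lie in the open convex hull of the following points: $$A(\alpha,0,0),\quad B(1,0,1-\alpha),\quad C_1\left(0,\tfrac{\alpha}{\omega_{\infty,1}},0\right),\quad C_2\left(0,\tfrac{\alpha}{\omega_{0,2}},0\right),$$ $$D_1\left(0,1,1-\tfrac{\alpha}{\omega_{\infty,1}}\right),\quad D_2\left(0,1,1-\tfrac{\alpha}{\omega_{0,2}}\right),\quad H\left(\tfrac{\omega_{\infty,1}-\alpha}{\omega_{\infty,1}},1,\tfrac{2(\omega_{\infty,1}-\alpha)}{\omega_{\infty,1}}\right),$$ together with - the point $G_1\left(1,\frac{1-\alpha}{2-\omega_{\infty,1}},\frac{2(1-\alpha)}{2-\omega_{\infty,1}}\right)$ if $\omega_{\infty,1}\le2\alpha$; - the two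 points $G_2^1\left(1,\frac{\alpha}{\omega_{\infty,1}},1\right)$ and $G_2^2\left(1,\frac12,1\right)$ if $2\alpha<\omega_{\infty,1}$. Then there exists a positive constant $C$ such that $$\|H_{\alpha,\gamma}(f,g)\|_{L^r(\mathbb{R})}\le C\|f\|_{L^p(\mathbb{R})}\|g\|_{L^q(\mathbb{R})}$$ for all $f\in L^p(\mathbb{R})$ and $g\in L^q(\mathbb{R})$.
   Context: $\mathbb{R}^+=(0,\infty)$. For $0<\alpha<1$, the bilinear fractional integral along the curve $(t,\gamma(t))$ is $$H_{\alpha,\gamma}(f,g)(x):=\int_0^\infty f(x-t)\,g(x-\gamma(t))\,\frac{dt}{t^{1-\alpha}},\qquad x\in\mathbb{R}.$$ The indices of $\gamma$ are $$\omega_{0,1}:=\liminf_{t\to0^+}\frac{\ln|\gamma(t)|}{\ln t},\quad \omega_{0,2}:=\limsup_{t\to0^+}\frac{\ln|\gamma(t)|}{\ln t},\quad \omega_{\infty,1}:=\liminf_{t\to\infty}\frac{\ln|\gamma(t)|}{\ln t},\quad \omega_{\infty,2}:=\limsup_{t\to\infty}\frac{\ln|\gamma(t)|}{\ln t}.$$ The open convex hull of a finite set of points in $\mathbb{R}^3$ is the interior of its convex hull. When $r<1$, $\|\cdot\|_{L^r}$ denotes the usual quasi-norm. *)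

(* Defs.v *)
From HB Require Import structures.
From mathcomp Require Import all_boot all_order all_algebra.
From mathcomp Require Import all_classical all_reals all_analysis.
From mathcomp Require Import complex.

Set Implicit Arguments.
Unset Strict Implicit.
Unset Printing Implicit Defensive.

Import Order.TTheory GRing.Theory Num.Theory.
Import numFieldNormedType.Exports.

Local Open Scope ring_scope.
Local Open Scope classical_set_scope.

Section Curve.
Context {R : realType}.
Implicit Type gamma : R -> R.

(* Curves are total functions on R of which only the values on (0, +oo) matter:
   all the notions below are local on the open half-line. *)
Definition C2_pos gamma : Prop :=
  forall t, 0 < t ->
    [/\ derivable gamma t 1, derivable gamma^`() t 1
      & {for t, continuous gamma^`(2)}].

Definition monotonic_pos gamma : Prop :=
  {in `]0, +oo[ &, {homo gamma : s t / s <= t}} \/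
  {in `]0, +oo[ &, {homo gamma : s t /~ s <= t}}.

Definition log_ratio gamma (t : R) : \bar R := (ln `|gamma t| / ln t)%:E.

Definition omega01 gamma : \bar R := limf_einf (log_ratio gamma) 0^'+.
Definition omega02 gamma : \bar R := limf_esup (log_ratio gamma) 0^'+.
Definition omegaoo1 gamma : \bar R := limf_einf (log_ratio gamma) +oo%R.

End Curve.

Section ComplexLp.
Context {R : realType}.
Local Notation mu := (@lebesgue_measure R).

Definition cmodulus (f : R -> R[i]) (x : R) : R := ComplexField.Normc.normc (f x).

Definition cmeasurable (D : set R) (f : R -> R[i]) : Prop :=
  measurable_fun D (fun x => complex.Re (f x)) /\
  measurable_fun D (fun x => complex.Im (f x)).

Definition cintegrable (D : set R) (f : R -> R[i]) : Prop :=
  mu.-integrable D (fun x => (complex.Re (f x))%:E) /\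
  mu.-integrable D (fun x => (complex.Im (f x))%:E).

(* Real and imaginary parts are integrated separately; this is the integral of
   f only where cintegrable D f holds. *)
Definition cintegral (D : set R) (f : R -> R[i]) : R[i] :=
  Complex (\int[mu]_(x in D) complex.Re (f x))
          (\int[mu]_(x in D) complex.Im (f x)).

(* For 0 < p this is the Lebesgue norm (quasi-norm if p < 1), +oo allowed. *)
Definition cLnorm (p : R) (f : R -> R[i]) : \bar R :=
  Lnorm mu p%:E (EFin \o cmodulus f).

Definition in_Lp (p : R) (f : R -> R[i]) : Prop :=
  cmeasurable setT f /\ (cLnorm p f < +oo)%E.

End ComplexLp.

Section Operator.
Context {R : realType}.
Implicit Types (alpha : R) (gamma : R -> R) (f g : R -> R[i]).

Definition Hintegrand alpha gamma f g (x t : R) : R[i] :=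
  f (x - t) * g (x - gamma t) * real_complex R (t `^ (1 - alpha))^-1.

Definition Hop alpha gamma f g (x : R) : R[i] :=
  cintegral `]0, +oo[ (Hintegrand alpha gamma f g x).

End Operator.

Section Hull.
Context {R : realType}.

(* R^o is R as a module over itself, needed for the R-module structure of the
   product. *)
Definition space3 := (R^o * R^o * R^o)%type.

Definition open_convex_hull (S : set space3) : set space3 :=
  interior (smallest (@convex_set R space3) S).

(* a and b stand for the (finite) indices omega_{oo,1} and omega_{0,2}. *)
Definition vertices (alpha a b : R) : set space3 :=
  [set (alpha, 0, 0)                                     (* A *)
     ; (1, 0, 1 - alpha)                                 (* B *)
     ; (0, alpha / a, 0)                                 (* C_1 *)
     ; (0, alpha / b, 0)                                 (* C_2 *)
     ; (0, 1, 1 - alpha / a)                             (* D_1 *)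
     ; (0, 1, 1 - alpha / b)                             (* D_2 *)
     ; ((a - alpha) / a, 1, 2 * (a - alpha) / a)]        (* H *)
  `|` (if a <= 2 * alpha then
         [set (1, (1 - alpha) / (2 - a), 2 * (1 - alpha) / (2 - a))]  (* G_1 *)
       else
         [set (1, alpha / a, 1)                          (* G_2^1 *)
            ; (1, 2^-1, 1)]).                            (* G_2^2 *)

End Hull.
Arguments space3 R : clear implicits.

(* Main.v *)
Require Import Defs.
From HB Require Import structures.
From mathcomp Require Import all_boot all_order all_algebra.
From mathcomp Require Import all_classical all_reals all_analysis.
From mathcomp Require Import complex.
From mathcomp Require Import ring lra measurable_realfun.
Import Order.TTheory GRing.Theory Num.Theory.
Import numFieldNormedType.Exports.
Local Open Scope ring_scope.
Local Open Scope classical_set_scope.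

(** Put F = |f|^p, G = |g|^q, x = 1/p, y = 1/q and z = 1/r.  Everything is about the
    positive operator sending F and G to the integral of
    F(s - t)^x G(s - gamma t)^y t^(alpha - 1) over t > 0, where F and G have mass at
    most 1.

    The half-line is cut into pieces on which t, gamma t / t and 1 - gamma' t are
    essentially constant: dyadic intervals near 0 and near infinity, and dyadic
    distances to the point t0 where gamma' = 1 (if there is one).  On one piece I there
    are three elementary averages: those of F(s - t), of G(s - gamma t) and of their
    product.  Changing variables (expanding_integral_le) bounds the first two in L^1
    and in sup norm, and the third in L^1.  Hoelder's inequality, first in t and
    then in s, interpolates between these bounds: positivity of the operator makes it
    do the work of an interpolation theorem.  Since a piece moves s by at most
    L = max(|I|, |gamma(I)|), the estimate can be made on windows of length L, where
    Hoelder's inequality also gives exponents r < 1, and the windows are put together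
    because z <= x + y (piece_estimate).

    The norms obtained are powers of the dyadic parameter, and a series of functions
    with geometrically decreasing L^r norms is in L^r, also for r < 1
    (quasi_norm_series, bounded_on_pieces).  What remains are the signs of the
    exponents.  With A = omega_{oo,1} and B = omega_{0,2} they are right if
      z > 2 (x + y - 1)                          near t0,
      A (x + y - z) > alpha and x - z + A y > alpha   at infinity,
      x + y - z < alpha and x + B (y - z) < alpha     at 0,
    together with x, y < 1 and z < x + y.  These are linear conditions which hold in
    the weak sense at all the vertices of the hull, hence strictly in its interior
    (hull_inequalities).  The powers of t to which gamma is compared are lower
    bounds, which is why the liminf at infinity and the limsup at 0 are the relevant
    indices; the bounds on the first derivative give the size of gamma' and the doubling
    of gamma, and the one on the second derivative makes gamma' leave the value 1 at a
    definite speed (bounded_small, bounded_large, bounded_middle). *)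

Set Implicit Arguments.
Unset Strict Implicit.
Unset Printing Implicit Defensive.

(** * Strict linear inequalities in an open convex hull *)

Section Hull.
Context {R : realType}.

(** A closed half-space containing S contains its convex hull, and an interior
    point of the hull can be moved a little along the outer normal (l1, l2, l3),
    so it cannot lie on the boundary plane. *)
Lemma hull_halfspace_lt (S : set (space3 R)) (l1 l2 l3 c : R) (x y z : R) :
  0 < l1 ^+ 2 + l2 ^+ 2 + l3 ^+ 2 ->
  (forall v, S v -> l1 * v.1.1 + l2 * v.1.2 + l3 * v.2 <= c) ->
  open_convex_hull S (x, y, z) ->
  l1 * x + l2 * y + l3 * z < c.
Proof.
move=> l_gt0 Sl Sxyz.
pose H : set (space3 R) := [set v | l1 * v.1.1 + l2 * v.1.2 + l3 * v.2 <= c].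
have cH : @convex_set R (space3 R) H.
  move=> u v k; rewrite !inE /H /= => uH vH.
  rewrite /conv/=.
  have k0 : 0 <= k%:num by [].
  have k1 : 0 <= 1 - k%:num by rewrite subr_ge0.
  have := lerD (ler_wpM2l k0 uH) (ler_wpM2l k1 vH).
  rewrite /unstable.onem /GRing.scale/= => uvH.
  apply: le_trans (_ : k%:num * c + (1 - k%:num) * c <= _); last first.
    by rewrite le_eqVlt; apply/orP; left; apply/eqP; ring.
  by apply: le_trans uvH; rewrite le_eqVlt; apply/orP; left; apply/eqP; ring.
have SH : smallest (@convex_set R (space3 R)) S `<=` H.
  by apply: smallest_sub => // v /Sl.
have nH : nbhs ((x, y, z) : space3 R) H.
  by apply: filterS SH _.
have cont : (fun e : R => ((x + e * l1, y + e * l2, z + e * l3) : space3 R))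
    @ (0 : R) --> ((x, y, z) : space3 R).
  have aux (a b : R) : (fun e : R => (a + e * b : R^o)) @ (0 : R) --> (a : R^o).
    rewrite -[X in _ --> X](_ : a + 0 * b = a); last by rewrite mul0r addr0.
    by apply: cvgD; [exact: cvg_cst | apply: cvgMl; exact: cvg_id].
  exact: (cvg_pair (cvg_pair (aux x l1) (aux y l2)) (aux z l3)).
have [e [e0 eH]] : exists e : R, 0 < e /\ H (x + e * l1, y + e * l2, z + e * l3).
  have /nbhs_ballP[d /= d0 dH] := cont H nH.
  exists (d / 2); split; first by rewrite divr_gt0.
  apply: dH; rewrite /ball/= sub0r normrN gtr0_norm ?divr_gt0//.
  by rewrite ltr_pdivrMr// ltr_pMr// ltr1n.
move: eH; rewrite /H/= => /(lt_le_trans _); apply.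
have := mulr_gt0 e0 l_gt0.
nra.
Qed.

End Hull.

Section Exponents.
Context {R : realType}.

(** Each of these inequalities holds in its weak form at all the vertices, where
    many of them are equalities; the interior makes them strict.  They say when the
    pieces of the integral sum up: the second bracket is convergence at infinity
    (first two) and at 0 (last two), and z > 2(x + y - 1) is convergence near a point
    where the curve has slope 1. *)
Lemma hull_inequalities (alpha A B x y z : R) :
  0 < alpha -> alpha < 1 -> 1 < B -> B <= A -> A <= alpha / (1 - alpha) ->
  open_convex_hull (vertices alpha A B) (x, y, z) ->
  [/\ x < 1, y < 1, z < x + y & 2 * (x + y - 1) < z] /\
  [/\ alpha < A * (x + y - z), alpha < x - z + A * y,
      x + y - z < alpha & x + B * (y - z) < alpha].
Proof.
move=> al0 al1 B1 BA Aal hull.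
have A1 : 1 < A by lra.
have A0 : 0 < A by lra.
have B0 : 0 < B by lra.
have al1' : 0 < 1 - alpha by lra.
have Aal' : A * (1 - alpha) <= alpha by rewrite -ler_pdivlMr.
have al2 : 1 / 2 < alpha by nra.
pose u := alpha / A; pose v := alpha / B.
have uA : u * A = alpha by rewrite /u divfK// gt_eqF.
have vB : v * B = alpha by rewrite /v divfK// gt_eqF.
have u0 : 0 < u by rewrite divr_gt0.
have v0 : 0 < v by rewrite divr_gt0.
have uv : u <= v by rewrite /u /v ler_pM2l// lef_pV2 ?posrE.
have val : v < alpha by nra.
have ual : 1 - alpha <= u by rewrite /u ler_pdivlMr// mulrC.
have uE : (A - alpha) / A = 1 - u by rewrite mulrBl divff ?gt_eqF.
(* With u = alpha/A and v = alpha/B the coordinates of the vertices are polynomial;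
   g is the second coordinate of G_1, kept abstract through g * (2 - A) = 1 - alpha. *)
have separate (l1 l2 l3 c : R) : 0 < l1 ^+ 2 + l2 ^+ 2 + l3 ^+ 2 ->
    l1 * alpha <= c -> l1 + l3 * (1 - alpha) <= c ->
    l2 * u <= c -> l2 * v <= c -> l2 + l3 * (1 - u) <= c -> l2 + l3 * (1 - v) <= c ->
    l1 * (1 - u) + l2 + l3 * (2 * (1 - u)) <= c ->
    (A <= 2 * alpha -> forall g, g * (2 - A) = 1 - alpha -> 1 - alpha <= g ->
       g <= 1 / 2 -> l1 + l2 * g + l3 * (2 * g) <= c) ->
    (2 * alpha < A -> l1 + l2 * u + l3 <= c /\ l1 + l2 * 2^-1 + l3 <= c) ->
    l1 * x + l2 * y + l3 * z < c.
  move=> l0 cA cB cC1 cC2 cD1 cD2 cH cG1 cG2.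
  apply: (hull_halfspace_lt l0 _ hull) => -[[v1 v2] v3] /= [|].
    move=> [[[[[[|]|]|]|]|]|] /= [-> -> ->]; rewrite ?uE -?/u -?/v.
    - lra.
    - lra.
    - lra.
    - lra.
    - lra.
    - lra.
    - by rewrite -mulrA uE; lra.
  case: ifPn => [A2 /= [-> -> ->]|]; last first.
    rewrite -real_ltNge ?num_real// => /cG2[cG cG'] /= [|] /= [-> -> ->]; rewrite -?/u; lra.
  have A2' : 0 < 2 - A by lra.
  rewrite -mulrA; apply: le_trans (cG1 A2 ((1 - alpha) / (2 - A)) _ _ _).
  - by rewrite mulr1.
  - by rewrite divfK// gt_eqF.
  - by rewrite ler_pdivlMr// ler_piMr; lra.
  - by rewrite ler_pdivrMr//; lra.
have Au : A * u = alpha by rewrite mulrC.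
have Bv : B * v = alpha by rewrite mulrC.
have Av : alpha <= A * v by rewrite -Au ler_pM2l.
have Bu : B * u <= alpha by rewrite -Bv ler_pM2l.
have u1 : u < 1 by lra.
have u_half : 2 * alpha < A -> u < 1 / 2 by move=> ?; rewrite /u ltr_pdivrMr//; lra.
move: u0 v0 uv val Au Bv Av Bu u1 u_half separate.
clearbody u v; clear -al0 al1 al2 B1 BA A1.
move=> u0 v0 uv val Au Bv Av Bu u1 u_half separate; split; split.
- suff: 1 * x + 0 * y + 0 * z < 1 by lra.
  (apply: separate => [||||||||A2 g gE g1 g2|/[dup] A2 /u_half u2]; last split); first [lra|nra].
- suff: 0 * x + 1 * y + 0 * z < 1 by lra.
  (apply: separate => [||||||||A2 g gE g1 g2|/[dup] A2 /u_half u2]; last split); first [lra|nra].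
- suff: -1 * x + -1 * y + 1 * z < 0 by lra.
  (apply: separate => [||||||||A2 g gE g1 g2|/[dup] A2 /u_half u2]; last split); first [lra|nra].
- suff: 2 * x + 2 * y + -1 * z < 2 by lra.
  (apply: separate => [||||||||A2 g gE g1 g2|/[dup] A2 /u_half u2]; last split); first [lra|nra].
- suff: - A * x + - A * y + A * z < - alpha by nra.
  (apply: separate => [||||||||A2 g gE g1 g2|/[dup] A2 /u_half u2]; last split); first [lra|nra].
- suff: -1 * x + - A * y + 1 * z < - alpha by lra.
  (apply: separate => [||||||||A2 g gE g1 g2|/[dup] A2 /u_half u2]; last split); first [lra|nra].
- suff: 1 * x + 1 * y + -1 * z < alpha by lra.
  (apply: separate => [||||||||A2 g gE g1 g2|/[dup] A2 /u_half u2]; last split); first [lra|nra].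
- suff: 1 * x + B * y + - B * z < alpha by nra.
  (apply: separate => [||||||||A2 g gE g1 g2|/[dup] A2 /u_half u2]; last split); first [lra|nra].
Qed.

Lemma small_multiplier (m v : R) : 0 < m -> 0 <= v ->
  exists2 e, 0 < e & forall e', 0 <= e' -> e' <= e -> e' * v < m.
Proof.
move=> m0 v0; have v1 : 0 < v + 1 by lra.
exists (m / (v + 1)); first exact: divr_gt0.
move=> e' e'0 /(ler_wpM2r v0)/le_lt_trans; apply.
by rewrite mulrAC ltr_pdivrMr// ltr_pM2l//; lra.
Qed.

(** w is the share of the product F G in the Hoelder splitting of F^x G^y, and eps is
    what is lost by replacing the indices of the curve by power bounds.  The strict
    inequalities leave room for both, and for w > 0. *)
Lemma exponents_choice (alpha A B x y z : R) :
  0 < x -> 0 < y -> 0 < z -> 1 < A ->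
  [/\ x < 1, y < 1, z < x + y & 2 * (x + y - 1) < z] /\
  [/\ alpha < A * (x + y - z), alpha < x - z + A * y,
      x + y - z < alpha & x + B * (y - z) < alpha] ->
  alpha < 1 ->
  exists w eps, [/\ 0 < w, x + y - 1 <= w, w <= x, w <= y & w <= z] /\
    [/\ 0 < eps, eps < A - 1, 0 < 1 - (x + y - z) - w,
      0 < (x + y - z) - alpha + (A - 1 - eps) * (y + Num.min x z - z) &
      0 < alpha - (x + y - z) - (B + eps - 1) * (y - Num.min y z)].
Proof.
move=> x0 y0 z0 A1 [[x1 y1 zs s2] [H1 H2 H3 H4]] al1.
pose m := Num.max 0 (x + y - 1).
pose M := Num.min (Num.min x y) (Num.min z (1 - (x + y - z))).
have mM : m < M by rewrite /m /M gt_max !lt_min; apply/andP; split;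
  (apply/andP; split; apply/andP; split); lra.
have m0 : 0 <= m by rewrite /m le_max lexx.
have m1 : x + y - 1 <= m by rewrite /m le_max lexx orbT.
have [Mx My Mz Ms] : [/\ M <= x, M <= y, M <= z & M <= 1 - (x + y - z)].
  by rewrite /M; split; rewrite !ge_min lexx ?orbT.
pose v1 := y + Num.min x z - z; pose v2 := y - Num.min y z.
have v1_ge0 : 0 <= v1 by rewrite /v1; case: (leP x z); lra.
have v2_ge0 : 0 <= v2 by rewrite /v2; case: (leP y z); lra.
have L1 : 0 < (x + y - z) - alpha + (A - 1) * v1.
  by rewrite /v1; case: (leP x z) => ?; lra.
have L2 : 0 < alpha - (x + y - z) - (B - 1) * v2.
  by rewrite /v2; case: (leP y z) => ?; lra.
have [e1 e10 He1] := small_multiplier L1 v1_ge0.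
have [e2 e20 He2] := small_multiplier L2 v2_ge0.
pose e := Num.min ((A - 1) / 2) (Num.min e1 e2).
have e0 : 0 < e by rewrite /e !lt_min e10 e20 !andbT; lra.
have [eA ee1 ee2] : [/\ e <= (A - 1) / 2, e <= e1 & e <= e2].
  by rewrite /e; split; rewrite !ge_min lexx ?orbT.
have S1 := He1 e (ltW e0) ee1; have S2 := He2 e (ltW e0) ee2.
clear He1 He2 ee1 ee2 H1 H2 H3 H4.
move: L1 L2 v1_ge0 v2_ge0 S1 S2; rewrite -/v1 -/v2; clearbody m M e v1 v2 => L1 L2 _ _ S1 S2.
exists ((m + M) / 2), e; split; split; lra.
Qed.

End Exponents.

(** * Maps that expand distances *)

Section Restriction.
Context d (T : measurableType d) (R : realType) (mu : {measure set T -> \bar R}).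
Local Open Scope ereal_scope.

Lemma integral_mrestr (I : set T) (mI : measurable I) (h : T -> \bar R) :
  measurable_fun setT h -> (forall t, 0 <= h t) ->
  \int[mrestr mu mI]_t h t = \int[mu]_(t in I) h t.
Proof.
move=> mh h0; have mIC : measurable (~` I) by exact: measurableC.
have Idisj : [disjoint I & ~` I] by apply/disj_setPS; rewrite setICr.
have hI : measurable_fun (I `|` ~` I) h by exact: measurable_funTS.
have := ge0_integral_setU (mrestr mu mI) mI mIC hI (fun x _ => h0 x) Idisj.
rewrite setUv => ->.
have -> : \int[mrestr mu mI]_(x in ~` I) h x = 0.
  rewrite -[RHS](integral_measure_zero (~` I) h).
  apply: eq_measure_integral => A mA AI; rewrite /= /mrestr /mzero.
  by rewrite (_ : A `&` I = set0) ?measure0//; apply/disjoints_subset.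
rewrite adde0; apply: eq_measure_integral => A mA AI.
by rewrite /= /mrestr; congr (mu _); apply/setIidPl.
Qed.

End Restriction.

Section Expanding.
Context {R : realType}.
Local Notation mu := (@lebesgue_measure R).
Local Open Scope ereal_scope.

Lemma lebesgue_measure_diam (A : set R) (d : R) :
  measurable A -> (0 <= d)%R -> (forall s t, A s -> A t -> (t - s <= d)%R) ->
  mu A <= d%:E.
Proof.
move=> mA d0 Ad; have [->|/set0P[a Aa]] := eqVneq A set0.
  by rewrite measure0 lee_fin.
have infA : has_inf A.
  by split; [exists a|exists (a - d)%R => t At; have := Ad _ _ At Aa; lra].
have sAI : A `<=` `[inf A, (inf A + d)%R].
  move=> t At /=; rewrite in_itv/=; apply/andP; split; first exact: ge_inf infA.2 _ At.
  rewrite -lerBlDr; apply: lb_le_inf; first by exists a.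
  by move=> s As; have := Ad _ _ As At; lra.
apply: le_trans (_ : mu `[inf A, (inf A + d)%R] <= _).
  by apply: le_measure; rewrite ?inE.
rewrite lebesgue_measure_itv/= lte_fin; case: ifPn => _; last by rewrite lee_fin.
by rewrite -EFinB lee_fin addrAC subrr add0r.
Qed.

(** The preimage of an interval has diameter at most 1/k times its length, and
    Lebesgue measure is an infimum over covers by intervals. *)
Lemma expanding_preimage_le (I : set R) (phi : R -> R) (k : R) (E : set R) :
  (0 < k)%R -> measurable I -> measurable_fun setT phi ->
  (forall s t, I s -> I t -> (k * `|t - s| <= `|phi t - phi s|)%R) ->
  measurable E -> mu (phi @^-1` E `&` I) <= (k^-1)%:E * mu E.
Proof.
move=> k0 mI mphi Iphi mE.
have kV : (0 < k^-1)%R by rewrite invr_gt0.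
have mpre (F : set R) : measurable F -> measurable (phi @^-1` F `&` I).
  by move=> mF; apply: measurableI => //; rewrite -[X in measurable X]setTI; exact: mphi.
rewrite [X in _ <= _ * X]/lebesgue_measure [X in _ <= _ * X]/lebesgue_stieltjes_measure.
rewrite [X in _ <= _ * X]/measure_extension.
rewrite muleC -lee_pdivrMr// /mu_ext.
apply: le_ereal_inf_tmp => _ /= [F [mF EF] <-].
rewrite lee_pdivrMr//.
apply: le_trans (_ : \sum_(0 <= n <oo) mu (phi @^-1` F n `&` I) <= _).
  apply: measure_sigma_subadditive => //.
  - by move=> n; apply: mpre; apply: sub_sigma_algebra; exact: mF.
  - exact: mpre.
  - by move=> t [/EF[n _ Fn] It]; exists n.
rewrite muleC -nneseriesZl; last first.
  by move=> n _; apply: (@wlength_ge0 R idfun).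
apply: lee_nneseries => [n _ _|n _]; first exact: measure_ge0.
have [[a b] _ /= <-] := mF n.
have [ab|ba] := leP a b; last first.
  rewrite set_itv_ge ?bnd_simp -?leNgt ?(ltW ba)// preimage_set0 set0I measure0.
  by rewrite wlength0 mule0.
rewrite wlength_itv_bnd//= -EFinM.
apply: lebesgue_measure_diam.
- by apply: mpre; exact: measurable_itv.
- by rewrite mulr_ge0// ?invr_ge0 ?subr_ge0 ?(ltW k0).
move=> s t [/= + Is] [/= + It]; rewrite !in_itv/= => /andP[as_ sb] /andP[at_ tb].
rewrite mulrC ler_pdivlMr// mulrC.
apply: le_trans (_ : k * `|t - s| <= _)%R.
  by rewrite ler_pM2l// ler_norm.
by apply: (le_trans (Iphi _ _ Is It)); rewrite ler_norml; lra.
Qed.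

(** This serves as change of variables throughout: the push-forward of Lebesgue
    measure by a map that expands distances by k is at most 1/k times Lebesgue
    measure. *)
Lemma expanding_integral_le (I : set R) (phi : R -> R) (k : R) (G : R -> \bar R) :
  (0 < k)%R -> measurable I -> measurable_fun setT phi ->
  (forall s t, I s -> I t -> (k * `|t - s| <= `|phi t - phi s|)%R) ->
  measurable_fun [set: R] G -> (forall t, 0 <= G t) ->
  \int[mu]_(t in I) G (phi t) <= (k^-1)%:E * \int[mu]_t G t.
Proof.
move=> k0 mI mphi Iphi mG G0.
have kN : (0 <= k^-1)%R by rewrite invr_ge0 ltW.
pose c : {nonneg R} := NngNum kN.
have mGphi : measurable_fun [set: R] (G \o phi) := measurableT_comp mG mphi.
pose nu := @pushforward _ _ (measurableTypeR R) (measurableTypeR R) R (mrestr mu mI) phi.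
have -> : (k^-1)%:E * \int[mu]_t G t = \int[mscale c mu]_t G t.
  by rewrite ge0_integral_mscale.
have -> : \int[mu]_(t in I) G (phi t) = \int[nu]_t G t.
  rewrite /nu (ge0_integral_pushforward
    (_ : @measurable_fun _ _ (measurableTypeR R) (measurableTypeR R) setT phi))//.
  rewrite preimage_setT integral_mrestr; first by [].
    exact: mGphi.
  by move=> t; exact: G0.
apply: ge0_le_measure_integral => //.
move=> S mS; rewrite /nu /pushforward /mscale /mrestr/=.
exact: expanding_preimage_le.
Qed.

End Expanding.

(** * Hoelder's inequality up to a constant *)

Section WeakHoelder.
Context {R : realType}.
Local Open Scope ereal_scope.

Lemma le_poweR (r : R) (x y : \bar R) : (0 <= r)%R -> 0 <= x -> x <= y ->
  x `^ r <= y `^ r.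
Proof.
move=> r0 x0 xy; apply: gt0_ler_poweR => //; rewrite in_itv/= leey andbT//.
exact: le_trans xy.
Qed.

(** With U the bracket on the right, each factor f^a is at most (c1 U)^a, and the
    exponents add up to 1; hence the product is at most the geometric mean of the c's
    times U.  The factor with exponent e stands for the constant function 1. *)
Lemma poweR_prod_le_sum (f g h : \bar R) (a b c e c1 c2 c3 c4 : R) :
  0 <= f -> 0 <= g -> 0 <= h ->
  (0 <= a)%R -> (0 <= b)%R -> (0 <= c)%R -> (0 <= e)%R -> (a + b + c + e = 1)%R ->
  (0 < c1)%R -> (0 < c2)%R -> (0 < c3)%R -> (0 < c4)%R ->
  f `^ a * g `^ b * h `^ c <= (c1 `^ a * c2 `^ b * c3 `^ c * c4 `^ e)%:E *
    ((c1^-1)%:E * f + (c2^-1)%:E * g + (c3^-1)%:E * h + (c4^-1)%:E).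
Proof.
move=> f0 g0 h0 a0 b0 c0 e0 abce c10 c20 c30 c40.
have V k : (0 < k)%R -> 0 <= (k^-1)%:E by move=> k0; rewrite lee_fin invr_ge0 ltW.
set U := (X in _ <= _ * X).
have U1 : (c1^-1)%:E * f <= U.
  rewrite /U -!addeA leeDl//; rewrite !adde_ge0// ?mule_ge0// ?V//.
have U2 : (c2^-1)%:E * g <= U.
  rewrite /U -!addeA addeCA leeDl//; rewrite !adde_ge0// ?mule_ge0// ?V//.
have U3 : (c3^-1)%:E * h <= U.
  by rewrite /U addeAC leeDr//; rewrite !adde_ge0// ?mule_ge0// ?V//.
have U4 : (c4^-1)%:E <= U by rewrite leeDr// !adde_ge0// ?mule_ge0// ?V//.
have U0 : 0 < U by apply: lt_le_trans U4; rewrite lte_fin invr_gt0.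
have aux (k r : R) (x : \bar R) : (0 < k)%R -> (0 <= r)%R -> 0 <= x ->
    (k^-1)%:E * x <= U -> x `^ r <= (k `^ r)%:E * U `^ r.
  move=> k0 r0 x0 xU; rewrite -poweR_EFin -poweRM ?lee_fin ?(ltW k0) ?(ltW U0)//.
  by apply: le_poweR => //; rewrite -lee_pdivrMl//.
have {U1} := aux _ _ _ c10 a0 f0 U1; have {U2} := aux _ _ _ c20 b0 g0 U2.
have {U3} := aux _ _ _ c30 c0 h0 U3; have {U4} : 1 `^ e <= (c4 `^ e)%:E * U `^ e.
  by apply: aux => //; rewrite mule1.
rewrite poweR1r; clear aux.
case: U U0 => [u||]// u0; last first.
  move=> _ _ _ _; rewrite gt0_muley ?leey// lte_fin !mulr_gt0// powR_gt0//.
have {}u0 : (0 < u)%R by rewrite -lte_fin.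
rewrite !poweR_EFin -!EFinM => U4 U3 U2 U1.
have ueq : (u = u `^ a * u `^ b * u `^ c * u `^ e)%R.
  by rewrite -!powRD ?abce ?powRr1 ?(ltW u0)//; apply/implyP => _; rewrite gt_eqF.
rewrite [X in _ <= X](_ : _ = (c1 `^ a * u `^ a)%:E * (c2 `^ b * u `^ b)%:E *
  (c3 `^ c * u `^ c)%:E * (c4 `^ e * u `^ e)%:E); last first.
  by rewrite -!EFinM [in LHS]ueq; congr EFin; ring.
rewrite -[leLHS]mule1.
by apply: lee_pmul => //; last (apply: lee_pmul => //; last apply: lee_pmul => //);
  rewrite ?mule_ge0 ?poweR_ge0.
Qed.

Context d (T : measurableType d) (mu : {measure set T -> \bar R}).

(** Hoelder's inequality with an extra factor 4, stated with positive real bounds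
    c1, ..., c4 instead of the integrals themselves: this avoids all discussion of
    vanishing or infinite integrals. *)
Lemma weak_hoelder (X : set T) (f g h : T -> \bar R) (a b c e c1 c2 c3 c4 : R) :
  measurable X ->
  measurable_fun X f -> measurable_fun X g -> measurable_fun X h ->
  (forall x, 0 <= f x) -> (forall x, 0 <= g x) -> (forall x, 0 <= h x) ->
  (0 <= a)%R -> (0 <= b)%R -> (0 <= c)%R -> (0 <= e)%R -> (a + b + c + e = 1)%R ->
  (0 < c1)%R -> (0 < c2)%R -> (0 < c3)%R -> (0 < c4)%R ->
  \int[mu]_(x in X) f x <= c1%:E -> \int[mu]_(x in X) g x <= c2%:E ->
  \int[mu]_(x in X) h x <= c3%:E -> mu X <= c4%:E ->
  \int[mu]_(x in X) (f x `^ a * g x `^ b * h x `^ c) <=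
    (4 * (c1 `^ a * c2 `^ b * c3 `^ c * c4 `^ e))%:E.
Proof.
move=> mX mf mg mh f0 g0 h0 a0 b0 c0 e0 abce c10 c20 c30 c40 If Ig Ih IX.
have V k : (0 < k)%R -> 0 <= (k^-1)%:E by move=> k0; rewrite lee_fin invr_ge0 ltW.
have mZ k u : measurable_fun X u -> measurable_fun X (fun x => (k : R)%:E * (u x : \bar R)).
  by move=> mu_; exact: measurable_funeM.
have Z0 k (u : T -> \bar R) : (0 < k)%R -> (forall x, 0 <= u x) ->
  forall x, X x -> 0 <= (k^-1)%:E * u x by move=> k0 u0 x _; rewrite mule_ge0// V.
have IZ k (u : T -> \bar R) : (0 < k)%R -> (forall x, 0 <= u x) -> measurable_fun X u ->
    \int[mu]_(x in X) u x <= k%:E -> \int[mu]_(x in X) ((k^-1)%:E * u x) <= 1.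
  move=> k0 u0 mu_ Iu; rewrite ge0_integralZl// ?V//.
  by rewrite lee_pdivrMl// mule1.
have K0 : (0 < c1 `^ a * c2 `^ b * c3 `^ c * c4 `^ e)%R by rewrite !mulr_gt0// powR_gt0.
pose U x := (c1^-1)%:E * f x + (c2^-1)%:E * g x + (c3^-1)%:E * h x + (c4^-1)%:E.
have mU : measurable_fun X U.
  by apply: emeasurable_funD => //; apply: emeasurable_funD;
    [apply: emeasurable_funD|]; exact: mZ.
apply: le_trans (_ : \int[mu]_(x in X)
    ((c1 `^ a * c2 `^ b * c3 `^ c * c4 `^ e)%:E * U x) <= _).
  apply: ge0_le_integral => //.
  - by move=> x _; rewrite !mule_ge0 ?poweR_ge0.
  - by do 2? apply: emeasurable_funM; apply: (measurableT_comp (measurable_poweR _)).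
  - exact: measurable_funeM.
  - by move=> x _; exact: poweR_prod_le_sum.
rewrite ge0_integralZl//; last 2 first.
  - by move=> x _; rewrite /U !adde_ge0 ?mule_ge0 ?V.
  - by rewrite lee_fin ltW.
rewrite (mulrC 4%R) [leRHS]EFinM lee_pmul2l ?lte_fin//.
have mV k : measurable_fun X (fun=> (k : R)%:E) by exact: measurable_cst.
rewrite [leRHS](_ : _ = 1 + 1 + 1 + 1); last by rewrite -!EFinD; congr EFin; ring.
have intD (u v : T -> \bar R) m n : measurable_fun X u -> measurable_fun X v ->
    (forall x, X x -> 0 <= u x) -> (forall x, X x -> 0 <= v x) ->
    \int[mu]_(x in X) u x <= m -> \int[mu]_(x in X) v x <= n ->
    \int[mu]_(x in X) (u x + v x) <= m + n.
  by move=> mu_ mv u0 v0 um vn; rewrite ge0_integralD//; exact: leeD.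
apply: (intD) => //.
- by apply: emeasurable_funD; [apply: emeasurable_funD|]; exact: mZ.
- by move=> x _; rewrite !adde_ge0 ?mule_ge0 ?V.
- by move=> x _; rewrite V.
- apply: (intD) => //; [|exact: mZ| |exact: Z0| |exact: IZ].
  + by apply: emeasurable_funD; exact: mZ.
  + by move=> x _; rewrite !adde_ge0 ?mule_ge0 ?V.
  + apply: (intD) => //; [exact: mZ|exact: mZ|exact: Z0|exact: Z0|exact: IZ|exact: IZ].
- by rewrite integral_cst// lee_pdivrMl// mule1.
Qed.

End WeakHoelder.

(** * Tonelli's theorem on measurable rectangles *)

Section Tonelli.
Context d1 d2 (T1 : measurableType d1) (T2 : measurableType d2) (R : realType).
Context (m1 : {sigma_finite_measure set T1 -> \bar R})
          (m2 : {sigma_finite_measure set T2 -> \bar R}).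
Local Open Scope ereal_scope.

Lemma measurable_integral_section (I : set T2) (h : T1 * T2 -> \bar R) :
  measurable I -> measurable_fun setT h -> (forall z, 0 <= h z) ->
  measurable_fun setT (fun x => \int[m2]_(t in I) h (x, t)).
Proof.
move=> mI mh h0.
have mST : measurable (setT `*` I : set (T1 * T2)) by exact: measurableX.
have mhr : measurable_fun setT (h \_ (setT `*` I)).
  by apply/(measurable_restrictT _ _).1 => //; exact: measurable_funTS.
have hr0 z : 0 <= (h \_ (setT `*` I)) z by rewrite patchE; case: ifP.
have := measurable_fun_fubini_tonelli_F (m2 := m2) _ mhr hr0.
congr (measurable_fun _ _); apply/funext => x.
rewrite /fubini_F [RHS]integral_mkcond; apply: eq_integral => t _.
by rewrite !patchE; congr (if _ then _ else _); apply/idP/idP; rewrite !inE //= => -[].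
Qed.

Lemma tonelli_in (X : set T1) (I : set T2) (h : T1 * T2 -> \bar R) :
  measurable X -> measurable I -> measurable_fun setT h -> (forall z, 0 <= h z) ->
  \int[m1]_(x in X) \int[m2]_(t in I) h (x, t) =
  \int[m2]_(t in I) \int[m1]_(x in X) h (x, t).
Proof.
move=> mX mI mh h0.
have mST : measurable (X `*` I : set (T1 * T2)) by exact: measurableX.
have mhr : measurable_fun setT (h \_ (X `*` I)).
  by apply/(measurable_restrictT _ _).1 => //; exact: measurable_funTS.
have hr0 z : 0 <= (h \_ (X `*` I)) z by rewrite patchE; case: ifP.
have := fubini_tonelli (m1 := m1) (m2 := m2) _ mhr hr0.
congr (_ = _); rewrite [RHS]integral_mkcond; apply: eq_integral => x _;
  rewrite [RHS]patchE; case: ifPn => xX.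
- rewrite [RHS]integral_mkcond; apply: eq_integral => t _; rewrite !patchE.
  by congr (if _ then _ else _); apply/idP/idP; move: xX; rewrite !inE //= => ? [].
- apply: integral0_eq => t _; rewrite patchE; case: ifPn => //.
  by rewrite inE/= => -[/mem_set]; rewrite (negbTE xX).
- rewrite [RHS]integral_mkcond; apply: eq_integral => t _; rewrite !patchE.
  by congr (if _ then _ else _); apply/idP/idP; move: xX; rewrite !inE //= => ? [].
- apply: integral0_eq => t _; rewrite patchE; case: ifPn => //.
  by rewrite inE/= => -[_ /mem_set]; rewrite (negbTE xX).
Qed.

End Tonelli.

(** * Averages along a curve *)

Section CurveAverage.
Context {R : realType}.
Local Notation mu := (@lebesgue_measure R).
Local Open Scope ereal_scope.
Context (gam : R -> R) (mgam : measurable_fun [set: R] gam).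
Implicit Types (u v : R -> R) (I X : set R).

Definition curve_avg I u v (x : R) : \bar R :=
  \int[mu]_(t in I) (u (x - t) * v (x - gam t))%:E.

Let joint u v (z : R * R) : \bar R := (u (z.1 - z.2) * v (z.1 - gam z.2))%:E.

Lemma measurable_joint u v :
  measurable_fun [set: R] u -> measurable_fun [set: R] v ->
  measurable_fun [set: R * R] (joint u v).
Proof.
move=> mu_ mv; apply/measurable_EFinP; apply: measurable_funM.
  apply: (measurableT_comp mu_); apply: measurable_funB.
    exact: measurable_fst.
  exact: measurable_snd.
apply: (measurableT_comp mv); apply: measurable_funB; first exact: measurable_fst.
by apply: (measurableT_comp mgam); exact: measurable_snd.
Qed.

Lemma curve_avg_ge0 I u v x : (forall t, 0 <= u t)%R -> (forall t, 0 <= v t)%R ->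
  0 <= curve_avg I u v x.
Proof. by move=> u0 v0; apply: integral_ge0 => t _; rewrite lee_fin mulr_ge0. Qed.

Lemma measurable_curve_avg I u v : measurable I ->
  measurable_fun [set: R] u -> measurable_fun [set: R] v ->
  (forall t, 0 <= u t)%R -> (forall t, 0 <= v t)%R ->
  measurable_fun [set: R] (curve_avg I u v).
Proof.
move=> mI mu_ mv u0 v0.
have := measurable_integral_section (T1 := measurableTypeR R) (T2 := measurableTypeR R)
  mu mI (measurable_joint mu_ mv).
by apply => z; rewrite lee_fin mulr_ge0.
Qed.

Lemma measurable_shift (x : R) : measurable_fun [set: R] (fun t => x - t)%R.
Proof. by apply: measurable_funB. Qed.

Lemma measurable_shift_curve (x : R) : measurable_fun [set: R] (fun t => x - gam t)%R.
Proof. by apply: measurable_funB. Qed.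

Lemma curve_avg1_le I u x : measurable I -> measurable_fun [set: R] u ->
  (forall t, 0 <= u t)%R ->
  curve_avg I u (cst 1%R) x <= \int[mu]_t (u t)%:E.
Proof.
move=> mI mu_ u0; rewrite /curve_avg /=.
under eq_integral do rewrite mulr1.
rewrite -[leRHS]mul1e -[X in X%:E * _]invr1.
apply: (@expanding_integral_le R I (fun t => x - t)%R 1 (EFin \o u)) => //.
- exact: measurable_shift.
- by move=> s t _ _; rewrite mul1r [leRHS]distrC [X in (_ <= `|X|)%R](_ : _ = t - s)%R//; ring.
- exact/measurable_EFinP.
Qed.

Lemma curve_avg2_le I v x k : (0 < k)%R -> measurable I -> measurable_fun [set: R] v ->
  (forall t, 0 <= v t)%R ->
  (forall s t, I s -> I t -> (k * `|t - s| <= `|gam t - gam s|)%R) ->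
  curve_avg I (cst 1%R) v x <= (k^-1)%:E * \int[mu]_t (v t)%:E.
Proof.
move=> k0 mI mv v0 Ik; rewrite /curve_avg /=.
under eq_integral do rewrite mul1r.
apply: (@expanding_integral_le R I (fun t => x - gam t)%R k (EFin \o v)) => //.
- exact: measurable_shift_curve.
- move=> s t Is It; apply: le_trans (Ik _ _ Is It) _; rewrite distrC le_eqVlt.
  by apply/orP; left; apply/eqP; congr (`|_|)%R; ring.
- exact/measurable_EFinP.
Qed.

Lemma translate_integral_le (v : R -> R) (c : R) : measurable_fun [set: R] v ->
  (forall t, 0 <= v t)%R -> \int[mu]_x (v (x - c))%:E <= \int[mu]_x (v x)%:E.
Proof.
move=> mv v0; rewrite -[leRHS]mul1e -[X in X%:E * _]invr1.
apply: (@expanding_integral_le R setT (fun x => x - c)%R 1 (EFin \o v)) => //.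
- exact: measurable_funB.
- by move=> s t _ _; rewrite mul1r [X in (_ <= `|X|)%R](_ : _ = t - s)%R//; ring.
- exact/measurable_EFinP.
Qed.

Lemma integral_curve_avgE I u v : measurable I ->
  measurable_fun [set: R] u -> measurable_fun [set: R] v ->
  (forall t, 0 <= u t)%R -> (forall t, 0 <= v t)%R ->
  \int[mu]_x curve_avg I u v x =
  \int[mu]_(t in I) \int[mu]_x (u (x - t) * v (x - gam t))%:E.
Proof.
move=> mI mu_ mv u0 v0.
have := tonelli_in (T1 := measurableTypeR R) (T2 := measurableTypeR R) mu mu
  measurableT mI (measurable_joint mu_ mv).
by apply => z; rewrite lee_fin mulr_ge0.
Qed.

Lemma integral_curve_avg_le I u v e l : measurable I -> mu I <= l%:E ->
  measurable_fun [set: R] u -> measurable_fun [set: R] v ->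
  (forall t, 0 <= u t)%R -> (forall t, 0 <= v t)%R -> (0 <= e)%R ->
  (forall t, \int[mu]_x (u (x - t) * v (x - gam t))%:E <= e%:E) ->
  \int[mu]_x curve_avg I u v x <= (l * e)%:E.
Proof.
move=> mI Il mu_ mv u0 v0 e0 uve; rewrite integral_curve_avgE//.
apply: le_trans (_ : \int[mu]_(t in I) e%:E <= _).
  apply: ge0_le_integral => //.
  - by move=> t _; apply: integral_ge0 => x _; rewrite lee_fin mulr_ge0.
  - apply: measurable_funTS.
    have := measurable_fun_fubini_tonelli_G (T1 := measurableTypeR R)
      (T2 := measurableTypeR R) (m1 := mu) _ (measurable_joint mu_ mv).
    by apply => z; rewrite lee_fin mulr_ge0.
by rewrite integral_cst// muleC EFinM; apply: lee_wpmul2r; rewrite ?lee_fin.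
Qed.

Lemma integral_curve_avg1_le I u e l : measurable I -> mu I <= l%:E ->
  measurable_fun [set: R] u -> (forall t, 0 <= u t)%R -> (0 <= e)%R ->
  \int[mu]_x (u x)%:E <= e%:E ->
  \int[mu]_x curve_avg I u (cst 1%R) x <= (l * e)%:E.
Proof.
move=> mI Il mu_ u0 e0 ue; apply: integral_curve_avg_le => //.
move=> t; apply: le_trans ue; under eq_integral do rewrite mulr1.
exact: translate_integral_le.
Qed.

Lemma integral_curve_avg2_le I v e l : measurable I -> mu I <= l%:E ->
  measurable_fun [set: R] v -> (forall t, 0 <= v t)%R -> (0 <= e)%R ->
  \int[mu]_x (v x)%:E <= e%:E ->
  \int[mu]_x curve_avg I (cst 1%R) v x <= (l * e)%:E.
Proof.
move=> mI Il mv v0 e0 ve; apply: integral_curve_avg_le => //.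
move=> t; apply: le_trans ve; under eq_integral do rewrite mul1r.
exact: translate_integral_le.
Qed.

(** Integrating in x first, the translation y = x - t turns the product into
    u(y) v(y + t - gam t); then t |-> t - gam t is used as a new variable, at the cost
    of the factor 1/J. *)
Lemma integral_curve_avg12_le I u v J e : (0 < J)%R -> (0 <= e)%R -> measurable I ->
  measurable_fun [set: R] u -> measurable_fun [set: R] v ->
  (forall t, 0 <= u t)%R -> (forall t, 0 <= v t)%R ->
  (forall s t, I s -> I t -> (J * `|t - s| <= `|(t - gam t) - (s - gam s)|)%R) ->
  \int[mu]_x (u x)%:E <= e%:E -> \int[mu]_x (v x)%:E <= e%:E ->
  \int[mu]_x curve_avg I u v x <= (J^-1 * e ^+ 2)%:E.
Proof.
move=> J0 e0 mI mu_ mv u0 v0 IJ ue ve; rewrite integral_curve_avgE//.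
pose h (z : R * R) : \bar R := (u z.1 * v (z.1 + (z.2 - gam z.2)))%:E.
have mh : measurable_fun [set: R * R] h.
  apply/measurable_EFinP; apply: measurable_funM.
    exact: (measurableT_comp mu_ measurable_fst).
  apply: (measurableT_comp mv); apply: measurable_funD; first exact: measurable_fst.
  apply: measurable_funB; first exact: measurable_snd.
  by apply: (measurableT_comp mgam); exact: measurable_snd.
have h0 z : 0 <= h z by rewrite lee_fin mulr_ge0.
apply: le_trans (_ : \int[mu]_(t in I) \int[mu]_y h (y, t) <= _).
  apply: ge0_le_integral => //.
  - by move=> t _; apply: integral_ge0 => x _; rewrite lee_fin mulr_ge0.
  - apply: measurable_funTS.
    have := measurable_fun_fubini_tonelli_G (T1 := measurableTypeR R)
      (T2 := measurableTypeR R) (m1 := mu) _ (measurable_joint mu_ mv).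
    by apply => z; rewrite lee_fin mulr_ge0.
  - apply: measurable_funTS.
    exact: (measurable_fun_fubini_tonelli_G (T1 := measurableTypeR R)
      (T2 := measurableTypeR R) (m1 := mu) _ mh h0).
  move=> t _; apply: le_trans
    (translate_integral_le (v := fun y => u y * v (y + (t - gam t)))%R t _ _).
  - under [leRHS]eq_integral do rewrite addrA subrK.
    by [].
  - apply: measurable_funM => //; apply: (measurableT_comp mv).
    by apply: measurable_funD.
  - by move=> y; rewrite mulr_ge0.
have := tonelli_in (T1 := measurableTypeR R) (T2 := measurableTypeR R) mu mu
  measurableT mI mh h0 => /= <-.
apply: le_trans (_ : \int[mu]_y ((u y)%:E * (J^-1 * e)%:E) <= _).
  apply: ge0_le_integral => //.
  - by move=> y _; apply: integral_ge0 => t _; exact: h0.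
  - exact: (measurable_integral_section (T1 := measurableTypeR R)
      (T2 := measurableTypeR R) mu mI mh h0).
  - by apply: emeasurable_funM => //; exact/measurable_EFinP.
  move=> y _; rewrite /h/=; under eq_integral do rewrite EFinM.
  have mvy : measurable_fun I (fun t => (v (y + (t - gam t)))%:E).
    apply/measurable_EFinP; apply: measurable_funTS; apply: (measurableT_comp mv).
    by apply: measurable_funD => //; exact: measurable_funB.
  rewrite (ge0_integralZl mu mI mvy) ?lee_fin//; last by move=> t _; rewrite lee_fin.
  rewrite lee_wpmul2l ?lee_fin//.
  apply: le_trans (_ : (J^-1)%:E * \int[mu]_t (v t)%:E <= _); last first.
    by rewrite EFinM lee_pmul2l ?lte_fin ?invr_gt0.
  apply: (@expanding_integral_le R I (fun t => y + (t - gam t))%R J (EFin \o v)) => //.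
  - by apply: measurable_funD => //; exact: measurable_funB.
  - move=> s t Is It; apply: le_trans (IJ _ _ Is It) _; rewrite le_eqVlt /=.
    by apply/orP; left; apply/eqP; congr (`|_|)%R; ring.
  - exact/measurable_EFinP.
have muE : measurable_fun [set: R] (fun y => (u y)%:E) by exact/measurable_EFinP.
rewrite (ge0_integralZr mu measurableT muE); last 2 first.
- by move=> y _; rewrite lee_fin.
- by rewrite lee_fin mulr_ge0 ?invr_ge0 ?(ltW J0).
rewrite [leRHS](_ : _ = e%:E * (J^-1 * e)%:E); last by rewrite -EFinM; congr EFin; ring.
by rewrite lee_wpmul2r ?lee_fin ?mulr_ge0 ?invr_ge0 ?(ltW J0).
Qed.

End CurveAverage.

(** * One piece of the curve, locally in x *)

Section LocalEstimate.
Context {R : realType}.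
Local Notation mu := (@lebesgue_measure R).
Context (gam : R -> R) (mgam : measurable_fun [set: R] gam).
Context (a b r w a' b' : R).
Hypotheses (a_gt0 : 0 < a) (b_gt0 : 0 < b) (r_gt0 : 0 < r) (w_gt0 : 0 < w) (w_ge : a + b - 1 <= w).
Hypotheses (a'_ge0 : 0 <= a') (b'_ge0 : 0 <= b').
Hypotheses (a'_le : a' <= a - w) (b'_le : b' <= b - w) (ab'_le : a' + b' + w <= r^-1).

(** The bound for one piece: I has length l and gam(I) length L, lam and J bound from
    below the expansion of gam and of t - gam t.  In the estimate of the integral of
    F^a G^b, a total exponent w is carried by F G, and the remaining exponents a - w of
    F and b - w of G are used partly (a' and b') through L^1 bounds in x and partly
    through sup bounds. *)
Definition piece_norm (l lam J L : R) : R :=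
  l `^ (1 - a - b + w + a' + b') * lam `^ (- (b - w - b')) * J `^ (- w) *
  L `^ (r^-1 - a' - b' - w).

Definition piece_const : R := 4 `^ r * 4 * 2 `^ (r * (a + b - w)).

Lemma powR_expR (x y : R) : 0 < x -> x `^ y = expR (y * ln x).
Proof. by move=> x0; rewrite /powR gt_eqF. Qed.

(** The left side is the constant that comes out of the two applications of Hoelder's
    inequality below. *)
Lemma piece_norm_identity (l lam J L e : R) :
  0 < l -> 0 < lam -> 0 < J -> 0 < L -> 0 < e ->
  (4 * l `^ (1 - a - b + w)) `^ r *
  ((2 * e) `^ (r * (a - w - a')) * (2 * (lam^-1 * e)) `^ (r * (b - w - b'))) *
  (4 * ((2 * (l * e)) `^ (r * a') * (2 * (l * e)) `^ (r * b') *
        (2 * (J^-1 * e ^+ 2)) `^ (r * w) * L `^ (1 - (r * a' + r * b' + r * w)))) =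
  piece_const * piece_norm l lam J L `^ r * e `^ (r * (a + b)).
Proof.
move=> l0 lam0 J0 L0 e0; rewrite /piece_const /piece_norm.
have p k : (0 : R) < k.+1%:R by rewrite ltr0n.
rewrite !powRM ?mulr_ge0 ?powR_ge0 ?invr_ge0 ?exprn_ge0 ?ler0n ?(ltW l0) ?(ltW lam0)
  ?(ltW J0) ?(ltW e0)//.
rewrite -!powRrM -![_^-1]powR_inv1 ?(ltW lam0) ?(ltW J0) ?(ltW r_gt0)//.
have -> : r `^ (-1) = r^-1 by rewrite powR_inv1 ?ltW.
rewrite !(powR_expR _ l0) !(powR_expR _ lam0) !(powR_expR _ J0) !(powR_expR _ L0)
  !(powR_expR _ e0) !(powR_expR _ (p 1%N)) !(powR_expR _ (p 3%N)).
rewrite -!expRM [LHS]mulrCA (mulrC (expR (r * ln 4)) 4) -!mulrA; congr (4 * _).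
rewrite -!expRD; congr expR; field.
by rewrite gt_eqF.
Qed.

Context (I : set R) (l lam J L : R).
Hypotheses (mI : measurable I) (muI : (mu I <= l%:E)%E).
Hypotheses (l_gt0 : 0 < l) (lam_gt0 : 0 < lam) (J_gt0 : 0 < J) (lL : l <= L)
  (laml : lam * l <= L).
Hypothesis gam_expand : forall s t, I s -> I t -> lam * `|t - s| <= `|gam t - gam s|.
Hypothesis id_gam_expand :
  forall s t, I s -> I t -> J * `|t - s| <= `|(t - gam t) - (s - gam s)|.

Section OneWindow.
Local Open Scope ereal_scope.
Context (F G : R -> R) (e : R) (X : set R).
Hypotheses (mF : measurable_fun [set: R] F) (mG : measurable_fun [set: R] G).
Hypotheses (F0 : forall t, (0 <= F t)%R) (G0 : forall t, (0 <= G t)%R) (e0 : (0 < e)%R).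
Hypotheses (Fe : \int[mu]_t (F t)%:E <= e%:E) (Ge : \int[mu]_t (G t)%:E <= e%:E).
Hypotheses (mX : measurable X) (muX : mu X <= L%:E).

Let L_gt0 : (0 < L)%R. Proof. exact: lt_le_trans lL. Qed.

(* The averages are increased by constants so that they are bounded below by positive
   reals; the constants are so small that the bounds at most double. *)
Let A x := curve_avg gam I F (cst 1%R) x + (l * e / L)%:E.
Let B x := curve_avg gam I (cst 1%R) G x + (l * e / L)%:E.
Let D x := curve_avg gam I F G x + (J^-1 * e ^+ 2 / L)%:E.

Let c_gt0 : (0 < l * e / L)%R. Proof. by rewrite divr_gt0// mulr_gt0. Qed.
Let cD_gt0 : (0 < J^-1 * e ^+ 2 / L)%R.
Proof. by rewrite divr_gt0// mulr_gt0 ?invr_gt0 ?exprn_gt0. Qed.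

Let A_le x : A x <= (2 * e)%:E.
Proof.
rewrite (_ : (2 * e)%R = e + e)%R ?EFinD; last by ring.
apply: leeD; first by apply: le_trans Fe; apply: curve_avg1_le.
by rewrite lee_fin mulrAC ler_piMl ?(ltW e0)// ler_pdivrMr// mul1r.
Qed.

Let B_le x : B x <= (2 * (lam^-1 * e))%:E.
Proof.
rewrite (_ : (2 * (lam^-1 * e))%R = lam^-1 * e + lam^-1 * e)%R ?EFinD; last by ring.
apply: leeD.
  apply: le_trans (curve_avg2_le mgam x lam_gt0 mI mG G0 gam_expand) _.
  by rewrite EFinM lee_pmul2l// lte_fin invr_gt0.
rewrite lee_fin mulrAC ler_pM2r// ler_pdivrMr// mulrC ler_pdivlMr//.
by rewrite mulrC.
Qed.

Let A_gt0 x : 0 < A x.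
Proof.
apply: (@lt_le_trans _ _ (l * e / L)%:E); first by rewrite lte_fin.
by rewrite leeDr// curve_avg_ge0.
Qed.
Let B_gt0 x : 0 < B x.
Proof.
apply: (@lt_le_trans _ _ (l * e / L)%:E); first by rewrite lte_fin.
by rewrite leeDr// curve_avg_ge0.
Qed.
Let D_gt0 x : 0 < D x.
Proof.
apply: (@lt_le_trans _ _ (J^-1 * e ^+ 2 / L)%:E); first by rewrite lte_fin.
by rewrite leeDr// curve_avg_ge0.
Qed.

Let mA : measurable_fun [set: R] A.
Proof. by apply: emeasurable_funD => //; apply: measurable_curve_avg. Qed.
Let mB : measurable_fun [set: R] B.
Proof. by apply: emeasurable_funD => //; apply: measurable_curve_avg. Qed.
Let mD : measurable_fun [set: R] D.
Proof. by apply: emeasurable_funD => //; apply: measurable_curve_avg. Qed.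

Let int_le (u v : R -> R) c : (0 <= c)%R ->
  measurable_fun [set: R] u -> measurable_fun [set: R] v ->
  (forall t, 0 <= u t)%R -> (forall t, 0 <= v t)%R ->
  \int[mu]_x curve_avg gam I u v x <= c%:E ->
  \int[mu]_(x in X) (curve_avg gam I u v x + (c / L)%:E) <= (2 * c)%:E.
Proof.
move=> c0 mu_ mv u0 v0 uvc.
have mM : measurable_fun [set: R] (curve_avg gam I u v) by exact: measurable_curve_avg.
rewrite ge0_integralD//; last 3 first.
- by move=> x _; rewrite curve_avg_ge0.
- exact: measurable_funTS.
- by move=> x _; rewrite lee_fin divr_ge0// ltW.
rewrite (_ : (2 * c)%R = c + c)%R ?EFinD; last by ring.
apply: leeD.
  apply: le_trans uvc; apply: ge0_subset_integral => //.
  by move=> x _; rewrite curve_avg_ge0.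
rewrite integral_cst//; apply: le_trans (_ : (c / L)%:E * L%:E <= _).
  by rewrite lee_wpmul2l// lee_fin divr_ge0// ltW.
by rewrite -EFinM lee_fin divfK// gt_eqF.
Qed.

Local Notation M := (curve_avg gam I (fun t => F t `^ a)%R (fun t => G t `^ b)%R).

(* Hoelder's inequality in t.  If D x is infinite the right side is infinite because
   the exponent w is positive. *)
Let M_le x : M x <= (4 * l `^ (1 - a - b + w))%:E *
   (A x `^ (a - w) * B x `^ (b - w) * D x `^ w).
Proof.
have [Dfin|] := boolP (D x \is a fin_num); last first.
  rewrite ge0_fin_numE ?(ltW (D_gt0 x))// ltey negbK => /eqP ->.
  rewrite poweRyr ?gt_eqF// gt0_muley; last by rewrite mule_gt0 ?poweR_gt0.
  by rewrite gt0_muley ?leey// lte_fin mulr_gt0// powR_gt0.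
have Afin : A x \is a fin_num.
  by rewrite ge0_fin_numE ?(ltW (A_gt0 x))// (le_lt_trans (A_le x))// ltry.
have Bfin : B x \is a fin_num.
  by rewrite ge0_fin_numE ?(ltW (B_gt0 x))// (le_lt_trans (B_le x))// ltry.
have := A_gt0 x; have := B_gt0 x; have := D_gt0 x.
have leA : curve_avg gam I F (cst 1%R) x <= A x by rewrite leeDl// lee_fin ltW.
have leB : curve_avg gam I (cst 1%R) G x <= B x by rewrite leeDl// lee_fin ltW.
have leD : curve_avg gam I F G x <= D x by rewrite leeDl// lee_fin ltW.
move: leA leB leD.
rewrite -(fineK Afin) -(fineK Bfin) -(fineK Dfin) !lte_fin => leA leB leD D0 B0 A0.
rewrite !poweR_EFin -!EFinM.
have H := @weak_hoelder R _ _ mu I (fun t => (F (x - t))%:E) (fun t => (G (x - gam t))%:E)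
  (fun t => (F (x - t) * G (x - gam t))%:E) (a - w) (b - w) w (1 - a - b + w)
  (fine (A x)) (fine (B x)) (fine (D x)) l mI.
have -> : M x = \int[mu]_(t in I) ((F (x - t))%:E `^ (a - w) *
    (G (x - gam t))%:E `^ (b - w) * (F (x - t) * G (x - gam t))%:E `^ w).
  apply: eq_integral => t _; rewrite !poweR_EFin -!EFinM powRM//; congr EFin.
  have -> : (F (x - t) `^ a = F (x - t) `^ (a - w) * F (x - t) `^ w)%R.
    by rewrite -powRD ?subrK//; apply/implyP; rewrite ?subrK gt_eqF.
  have -> : (G (x - gam t) `^ b = G (x - gam t) `^ (b - w) * G (x - gam t) `^ w)%R.
    by rewrite -powRD ?subrK//; apply/implyP; rewrite ?subrK gt_eqF.
  by ring.
have mFx : measurable_fun I (fun t => (F (x - t))%:E).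
  apply/measurable_EFinP/measurable_funTS.
  exact: (measurableT_comp mF (measurable_shift x)).
have mGx : measurable_fun I (fun t => (G (x - gam t))%:E).
  apply/measurable_EFinP/measurable_funTS.
  exact: (measurableT_comp mG (measurable_shift_curve mgam x)).
apply: le_trans; first apply: H => //.

- apply/measurable_EFinP; apply: measurable_funM; apply: measurable_funTS.
    exact: (measurableT_comp mF (measurable_shift x)).
  exact: (measurableT_comp mG (measurable_shift_curve mgam x)).
- by move=> t; rewrite lee_fin.
- by move=> t; rewrite lee_fin.
- by move=> t; rewrite lee_fin mulr_ge0.
- by rewrite (le_trans a'_ge0).
- by rewrite (le_trans b'_ge0).
- exact: ltW.
- by rewrite (_ : (1 - a - b + w)%R = (w - (a + b - 1))%R) ?subr_ge0//; ring.
- by ring.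
- apply: le_trans leA; rewrite /curve_avg /=.
  by under [leRHS]eq_integral do rewrite mulr1.
- apply: le_trans leB; rewrite /curve_avg /=.
  by under [leRHS]eq_integral do rewrite mul1r.
- by rewrite lee_fin -[leRHS]mulrA (mulrC (l `^ _)%R).
Qed.

Let pointwise_le x : M x `^ r <= ((4 * l `^ (1 - a - b + w)) `^ r *
    ((2 * e) `^ (r * (a - w - a')) * (2 * (lam^-1 * e)) `^ (r * (b - w - b'))))%:E *
  (A x `^ (r * a') * B x `^ (r * b') * D x `^ (r * w)).
Proof.
have M0 : 0 <= M x by apply: curve_avg_ge0 => t; exact: powR_ge0.
have r0 : (0 <= r)%R by exact: ltW.
apply: le_trans (le_poweR r0 M0 (M_le x)) _.
have split_pow (U : \bar R) (c s s' : R) : 0 < U -> U <= c%:E -> (0 <= s')%R -> (s' <= s)%R ->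
    (U `^ s) `^ r <= (c `^ (r * (s - s')))%:E * U `^ (r * s').
  move=> U0 Uc s'0 ss'.
  have Ufin : U \is a fin_num by rewrite ge0_fin_numE ?(ltW U0)// (le_lt_trans Uc)// ltry.
  rewrite -poweRrM (_ : s * r = r * (s - s') + r * s')%R; last by ring.
  rewrite poweRD; last by rewrite /poweRD_def Ufin (gt_eqF U0) !implybT.
  rewrite lee_wpmul2r ?poweR_ge0// -poweR_EFin.
  by apply: le_poweR => //; rewrite ?mulr_ge0 ?subr_ge0 ?(ltW U0).
have K0 : (0 <= 4 * l `^ (1 - a - b + w))%R by rewrite mulr_ge0 ?powR_ge0.
rewrite poweRM ?lee_fin ?mule_ge0 ?poweR_ge0// poweR_EFin.
rewrite !EFinM -!muleA lee_wpmul2l ?lee_fin ?powR_ge0//.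
rewrite !poweRM ?mule_ge0 ?poweR_ge0//.
rewrite -[(D x `^ w) `^ r]poweRrM [(w * r)%R]mulrC.
have HA := split_pow _ _ _ _ (A_gt0 x) (A_le x) a'_ge0 a'_le.
have HB := split_pow _ _ _ _ (B_gt0 x) (B_le x) b'_ge0 b'_le.
have := lee_pmul _ _ HA HB; rewrite !poweR_ge0 => /(_ erefl erefl) HAB.
rewrite !muleA lee_wpmul2r ?poweR_ge0//.
apply: le_trans HAB _; rewrite !muleA le_eqVlt; apply/orP; left; apply/eqP.
by rewrite -!muleA; congr (_ * _); rewrite muleCA.
Qed.

(** Hoelder's inequality in x on a set X of measure at most L.  The factor
    L^(1/r - a' - b' - w) in the norm of the piece comes from the part of the exponent
    1/r that the three averages do not use, which may be positive; so r < 1 is covered. *)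
Lemma local_piece_estimate :
  \int[mu]_(x in X) (M x `^ r) <=
    (piece_const * piece_norm l lam J L `^ r * e `^ (r * (a + b)))%:E.
Proof.
have r0 : (0 <= r)%R by exact: ltW.
have mM : measurable_fun [set: R] M.
  apply: measurable_curve_avg => //; try by move=> t; exact: powR_ge0.
  - exact: (measurableT_comp (measurable_powR a) mF).
  - exact: (measurableT_comp (measurable_powR b) mG).
set K := ((4 * l `^ (1 - a - b + w)) `^ r *
    ((2 * e) `^ (r * (a - w - a')) * (2 * (lam^-1 * e)) `^ (r * (b - w - b'))))%R.
have K0 : (0 <= K)%R by rewrite !mulr_ge0 ?powR_ge0.
have mP : measurable_fun X (fun x => A x `^ (r * a') * B x `^ (r * b') * D x `^ (r * w)).
  by do 2? apply: emeasurable_funM; apply: (measurableT_comp (measurable_poweR _));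
    exact: measurable_funTS.
have P0 x : X x -> 0 <= A x `^ (r * a') * B x `^ (r * b') * D x `^ (r * w).
  by move=> _; rewrite !mule_ge0 ?poweR_ge0.
apply: le_trans (_ : \int[mu]_(x in X)
   (K%:E * (A x `^ (r * a') * B x `^ (r * b') * D x `^ (r * w))) <= _).
  apply: ge0_le_integral => //.
  - by move=> x _; exact: poweR_ge0.
  - by apply: (measurableT_comp (measurable_poweR _)); exact: measurable_funTS.
  - exact: measurable_funeM.
rewrite ge0_integralZl// ?lee_fin//.
rewrite -piece_norm_identity// -/K [leRHS]EFinM lee_wpmul2l ?lee_fin//.
have le0 : (0 <= l * e)%R by rewrite mulr_ge0 ?ltW.
have Je0 : (0 < J^-1 * e ^+ 2)%R by rewrite mulr_gt0 ?invr_gt0 ?exprn_gt0.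
apply: weak_hoelder => //; try exact: measurable_funTS.
- by move=> x; exact: ltW.
- by move=> x; exact: ltW.
- by move=> x; exact: ltW.
- by rewrite mulr_ge0.
- by rewrite mulr_ge0.
- by rewrite mulr_ge0 ?(ltW w_gt0).
- rewrite subr_ge0 -!mulrDr -(mulfV (lt0r_neq0 r_gt0)).
  by rewrite ler_pM2l.
- by rewrite addrC subrK.
- by rewrite !mulr_gt0.
- by rewrite !mulr_gt0.
- by rewrite mulr_gt0.
- by apply: int_le => //; exact: integral_curve_avg1_le (ltW _) _.
- by apply: int_le => //; exact: integral_curve_avg2_le (ltW _) _.
- apply: int_le => //; first exact: ltW.
  exact: integral_curve_avg12_le (ltW _) _ _ _ _ _ _ _ _.
Qed.

End OneWindow.

End LocalEstimate.

(** * One piece of the curve, globally *)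

Section Windows.
Context {R : realType}.
Local Notation mu := (@lebesgue_measure R).
Local Open Scope ereal_scope.

Definition window (u v L : R) : set R := [set y | u + v <= y <= u + v + L]%R.

Lemma windowE u v L : window u v L = `[(u + v)%R, (u + v + L)%R].
Proof. by apply/seteqP; split => y; rewrite /window/= in_itv. Qed.

Lemma measurable_window u v L : measurable (window u v L).
Proof. by rewrite windowE; exact: measurable_itv. Qed.

Lemma window_measure u v L : (0 <= L)%R -> mu (window u v L) = L%:E.
Proof.
move=> L0; rewrite windowE lebesgue_measure_itv/= lte_fin ltrDl lt_neqAle L0 andbT.
have [<-//|_] := eqVneq 0%R L; rewrite -EFinB; congr EFin; ring.
Qed.

Let strip (v L : R) : set (R * R) := (fun z => z.2 - z.1)%R @^-1` `[v, (v + L)%R].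

Let measurable_strip v L : measurable (strip v L : set (R * R)).
Proof.
rewrite -[X in measurable X]setTI; apply: (_ : measurable_fun setT _) => //.
by apply: measurable_funB; [exact: measurable_snd|exact: measurable_fst].
Qed.

Let in_strip u y v L : ((u, y) \in strip v L) = (y \in window u v L).
Proof.
apply/idP/idP; rewrite !inE /strip /window/= in_itv/= => /andP[? ?]; apply/andP; split; lra.
Qed.

Lemma integral_window (v L : R) (h : R -> \bar R) : (0 <= L)%R ->
  measurable_fun [set: R] h -> (forall y, 0 <= h y) ->
  \int[mu]_u \int[mu]_(y in window u v L) h y = L%:E * \int[mu]_y h y.
Proof.
move=> L0 mh h0.
pose k (z : R * R) : \bar R := h z.2 * (\1_(strip v L) z)%:E.
have mk : measurable_fun [set: R * R] k.
  apply: emeasurable_funM; first exact: (measurableT_comp mh measurable_snd).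
  by apply/measurable_EFinP; exact: measurable_indic.
have k0 z : 0 <= k z by rewrite mule_ge0// lee_fin.
have := tonelli_in (T1 := measurableTypeR R) (T2 := measurableTypeR R) mu mu
  measurableT measurableT mk k0; congr (_ = _).
  apply: eq_integral => u _; rewrite [RHS]integral_mkcond; apply: eq_integral => y _.
  rewrite /k/= patchE indicE.
  by rewrite in_strip; case: ifP; rewrite ?mule1 ?mule0.
rewrite -[RHS]ge0_integralZl//; apply: eq_integral => y _.
have stripE u : \1_(strip v L) (u, y) = \1_(window y (- v - L) L) u :> R.
  rewrite !indicE; congr (_%:R); congr nat_of_bool.
  apply/idP/idP; rewrite !inE /strip /window/= in_itv/= => /andP[? ?]; apply/andP; split; lra.
rewrite /k/=; under eq_integral do rewrite stripE.
have mW : measurable_fun [set: R] (fun u => (\1_(window y (- v - L) L) u)%:E : \bar R).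
  by apply/measurable_EFinP; apply: measurable_indic; exact: measurable_window.
rewrite (ge0_integralZl mu measurableT mW)//.
rewrite integral_indic//; last exact: measurable_window.
rewrite setIT [X in _ * X](_ : _ = L%:E); first by rewrite muleC.
exact: window_measure.
Qed.

Lemma measurable_window_integral (v L : R) (h : R -> \bar R) :
  measurable_fun [set: R] h -> (forall y, 0 <= h y) ->
  measurable_fun [set: R] (fun u => \int[mu]_(y in window u v L) h y).
Proof.
move=> mh h0.
pose k (z : R * R) : \bar R := h z.2 * (\1_(strip v L) z)%:E.
have mk : measurable_fun [set: R * R] k.
  apply: emeasurable_funM; first exact: (measurableT_comp mh measurable_snd).
  by apply/measurable_EFinP; exact: measurable_indic.
have k0 z : 0 <= k z by rewrite mule_ge0// lee_fin.
have := measurable_integral_section (T1 := measurableTypeR R) (T2 := measurableTypeR R) mu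
  measurableT mk k0; congr (measurable_fun _ _); apply/funext => u.
rewrite [RHS]integral_mkcond; apply: eq_integral => y _.
rewrite /k/= patchE indicE.
by rewrite in_strip; case: ifP; rewrite ?mule1 ?mule0.
Qed.

End Windows.

Section PieceEstimate.
Context {R : realType}.
Local Notation mu := (@lebesgue_measure R).
Local Open Scope ereal_scope.
Context (gam : R -> R) (mgam : measurable_fun [set: R] gam).
Context (a b r w a' b' : R).
Hypotheses (a_gt0 : (0 < a)%R) (b_gt0 : (0 < b)%R) (r_gt0 : (0 < r)%R) (w_gt0 : (0 < w)%R).
Hypotheses (w_ge : (a + b - 1 <= w)%R) (a'_ge0 : (0 <= a')%R) (b'_ge0 : (0 <= b')%R).
Hypotheses (a'_le : (a' <= a - w)%R) (b'_le : (b' <= b - w)%R).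
Hypotheses (ab'_le : (a' + b' + w <= r^-1)%R) (ab_ge : (1 <= r * (a + b))%R).
Context (I : set R) (l lam J L c d : R).
Hypotheses (mI : measurable I) (l_gt0 : (0 < l)%R) (lam_gt0 : (0 < lam)%R) (J_gt0 : (0 < J)%R)
  (lL : (l <= L)%R) (laml : (lam * l <= L)%R).
Hypothesis I_window : forall t, I t -> (c <= t <= c + l)%R.
Hypothesis gamI_window : forall t, I t -> (d <= gam t <= d + L)%R.
Hypothesis gam_expand :
  forall s t, I s -> I t -> (lam * `|t - s| <= `|gam t - gam s|)%R.
Hypothesis id_gam_expand :
  forall s t, I s -> I t -> (J * `|t - s| <= `|(t - gam t) - (s - gam s)|)%R.
Context (F G : R -> R).
Hypotheses (mF : measurable_fun [set: R] F) (mG : measurable_fun [set: R] G).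
Hypotheses (F0 : forall t, (0 <= F t)%R) (G0 : forall t, (0 <= G t)%R).
Hypotheses (F1 : \int[mu]_t (F t)%:E <= 1) (G1 : \int[mu]_t (G t)%:E <= 1).

Let L_gt0 : (0 < L)%R. Proof. exact: lt_le_trans lL. Qed.
Let muI : mu I <= l%:E.
Proof.
apply: lebesgue_measure_diam => //; first exact: ltW.
by move=> s t /I_window/andP[? ?] /I_window/andP[? ?]; lra.
Qed.

Local Notation M :=
  (curve_avg gam I (fun t => F t `^ a)%R (fun t => G t `^ b)%R).
(* For x in the window [u, u + L] and t in I, the points x - t and x - gam t stay in
   windows of length 2 L, so only the masses of F and G there matter. *)
Let massF u := \int[mu]_(y in window u (- c - L)%R (2 * L)%R) (F y)%:E.
Let massG u := \int[mu]_(y in window u (- d - L)%R (2 * L)%R) (G y)%:E.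
Let K := (piece_const a b r w * piece_norm a b r w a' b' l lam J L `^ r)%R.

Let mE (u : R -> R) : measurable_fun [set: R] u -> measurable_fun [set: R] (EFin \o u).
Proof. by move=> ?; exact/measurable_EFinP. Qed.

Let K_gt0 : (0 < K)%R.
Proof.
have p k : (0 < k.+1%:R :> R)%R by rewrite ltr0n.
by rewrite /K /piece_const /piece_norm !mulr_gt0 ?powR_gt0// ?mulr_gt0 ?powR_gt0 ?p.
Qed.

Let mM : measurable_fun [set: R] M.
Proof.
apply: measurable_curve_avg => //; try by move=> t; exact: powR_ge0.
- exact: (measurableT_comp (measurable_powR a) mF).
- exact: (measurableT_comp (measurable_powR b) mG).
Qed.

Let mMr : measurable_fun [set: R] (fun x => M x `^ r).
Proof. exact: (measurableT_comp (measurable_poweR r) mM). Qed.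

Let window_estimate u (e : R) : (0 < e)%R -> massF u <= e%:E -> massG u <= e%:E ->
  \int[mu]_(x in window u 0 L) (M x `^ r) <= (K * e `^ (r * (a + b)))%:E.
Proof.
move=> e0 Fe Ge.
pose WF := window u (- c - L)%R (2 * L)%R; pose WG := window u (- d - L)%R (2 * L)%R.
pose Fu t := (F t * \1_WF t)%R; pose Gu t := (G t * \1_WG t)%R.
have mWF : measurable WF by exact: measurable_window.
have mWG : measurable WG by exact: measurable_window.
have intE (h : R -> R) (W : set R) : measurable W ->
    \int[mu]_t (h t * \1_W t)%:E = \int[mu]_(t in W) (h t)%:E.
  move=> mW; rewrite [RHS]integral_mkcond; apply: eq_integral => t _.
  by rewrite patchE indicE; case: ifP => _; rewrite ?mulr1 ?mulr0.
have shift_window (k x t : R) : (u <= x -> x <= u + L -> k <= t -> t <= k + L ->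
    u + (- k - L) <= x - t <= u + (- k - L) + 2 * L)%R.
  by move=> ? ? ? ?; apply/andP; split; lra.
have -> : \int[mu]_(x in window u 0 L) (M x `^ r) = \int[mu]_(x in window u 0 L)
    (curve_avg gam I (fun t => Fu t `^ a)%R (fun t => Gu t `^ b)%R x `^ r).
  apply: eq_integral => x; rewrite inE /window/= addr0 => /andP[ux xu].
  congr (_ `^ r); apply: eq_integral => t; rewrite inE => It.
  have /andP[ct tc] := I_window It; have /andP[dt td] := gamI_window It.
  rewrite /Fu /Gu !indicE.
  have -> : (x - t)%R \in WF.
    rewrite inE; apply: shift_window => //; apply: le_trans tc _.
    by rewrite lerD2l.
  have -> : (x - gam t)%R \in WG by rewrite inE; exact: shift_window.
  by rewrite !mulr1.
apply: local_piece_estimate => //.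
- by apply: measurable_funM.
- by apply: measurable_funM.
- by move=> t; rewrite mulr_ge0.
- by move=> t; rewrite mulr_ge0.
- by rewrite intE.
- by rewrite intE.
- exact: measurable_window.
- by rewrite window_measure// ltW.
Qed.

Let massF_ge0 u : 0 <= massF u.
Proof. by apply: integral_ge0 => y _; rewrite lee_fin. Qed.
Let massG_ge0 u : 0 <= massG u.
Proof. by apply: integral_ge0 => y _; rewrite lee_fin. Qed.

Let mass_restrict_le1 (h : R -> R) (W : set R) : measurable W -> measurable_fun [set: R] h ->
  (forall t, 0 <= h t)%R -> \int[mu]_t (h t)%:E <= 1 -> \int[mu]_(t in W) (h t)%:E <= 1.
Proof.
move=> mW mh h0 h1; apply: le_trans h1; apply: ge0_subset_integral => //; first exact: mE.
by move=> t _; rewrite lee_fin.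
Qed.

Let Q := (K * 3 `^ (r * (a + b)))%R.

(* The local estimate is homogeneous of degree r (a + b) >= 1 in the mass e, and e is
   at most 3; so it can be made linear in the two masses.  The number e exceeds their
   sum by an arbitrary small amount because it has to be positive. *)
Let window_bound u :
  \int[mu]_(x in window u 0 L) (M x `^ r) <= Q%:E * (massF u + massG u).
Proof.
have massF1 : massF u <= 1 by apply: mass_restrict_le1 => //; exact: measurable_window.
have massG1 : massG u <= 1 by apply: mass_restrict_le1 => //; exact: measurable_window.
have Ffin : massF u \is a fin_num by rewrite ge0_fin_numE// (le_lt_trans massF1)// ltry.
have Gfin : massG u \is a fin_num by rewrite ge0_fin_numE// (le_lt_trans massG1)// ltry.
have Q_gt0 : (0 < Q)%R by rewrite mulr_gt0// powR_gt0.
move: (massF_ge0 u) (massG_ge0 u) massF1 massG1 (@window_estimate u).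
rewrite -(fineK Ffin) -(fineK Gfin) !lee_fin.
move: (fine (massF u)) (fine (massG u)) => f g f0 g0 f1 g1 est.
apply/lee_addgt0Pr => eps eps0.
pose e := Num.min 1%R (eps / Q)%R.
have e0 : (0 < e)%R by rewrite lt_min ltr01 divr_gt0.
have e1 : (e <= 1)%R by rewrite ge_min lexx.
have eQ : (Q * e <= eps)%R by rewrite mulrC -ler_pdivlMr// ge_min lexx orbT.
have fge0 : (0 < f + g + e)%R by lra.
have fge1 : (f <= f + g + e)%R by lra.
have fge2 : (g <= f + g + e)%R by lra.
have := est _ fge0; rewrite !lee_fin => /(_ fge1 fge2)/le_trans; apply.
rewrite -EFinD lee_fin.
apply: le_trans (_ : Q * (f + g + e) <= _)%R; last by rewrite mulrDr lerD2l.
rewrite /Q -mulrA ler_pM2l//.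
have -> : (f + g + e = 3 * ((f + g + e) / 3))%R by field.
rewrite powRM//; [|lra]; rewrite ler_pM2l ?powR_gt0//.
set s := ((f + g + e) / 3)%R.
have s0 : (0 < s)%R by rewrite /s; lra.
have s1 : (s <= 1)%R by rewrite /s; lra.
apply: le_trans (_ : s <= _)%R; last by lra.
by apply: ge1r_powR => //; rewrite s0.
Qed.

(** An integral over the line is the average over u of the integrals over [u, u + L],
    and the masses in the windows integrate to 2 L times the total masses. *)
Theorem piece_estimate : \int[mu]_x (M x `^ r) <= (4 * Q)%:E.
Proof.
have Q_ge0 : (0 <= Q)%R by rewrite mulr_ge0 ?powR_ge0// ltW.
have L_ge0 : (0 <= L)%R by exact: ltW.
have mmF : measurable_fun [set: R] massF.
  by apply: measurable_window_integral => [|y]; [exact: mE|rewrite lee_fin].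
have mmG : measurable_fun [set: R] massG.
  by apply: measurable_window_integral => [|y]; [exact: mE|rewrite lee_fin].
rewrite -(@lee_pmul2l _ L%:E)//.
rewrite -(@integral_window R 0 L)//; last by move=> y; exact: poweR_ge0.
apply: le_trans (_ : \int[mu]_u (Q%:E * (massF u + massG u)) <= _).
  apply: ge0_le_integral => //.
  - by move=> u _; apply: integral_ge0 => x _; exact: poweR_ge0.
  - by apply: measurable_window_integral => // y; exact: poweR_ge0.
  - by apply: measurable_funeM; exact: emeasurable_funD.
rewrite ge0_integralZl//; last 2 first.
- exact: emeasurable_funD.
- by move=> u _; rewrite adde_ge0.
rewrite (_ : L%:E * (4 * Q)%:E = Q%:E * ((2 * L)%:E + (2 * L)%:E)); last first.
  by rewrite -EFinD -!EFinM; congr EFin; ring.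
rewrite lee_wpmul2l ?lee_fin// ge0_integralD//.
have LL : (0 <= 2 * L)%R by rewrite mulr_ge0.
apply: leeD.
  rewrite /massF (integral_window _ LL (mE mF))//.
  by rewrite -[leRHS]mule1 lee_wpmul2l ?lee_fin.
rewrite /massG (integral_window _ LL (mE mG))//.
by rewrite -[leRHS]mule1 lee_wpmul2l ?lee_fin.
Qed.

End PieceEstimate.

(** * Series of functions in L^r *)

Section GeometricSums.
Context {R : realType}.
Local Open Scope ereal_scope.

Lemma nneseries_geometric_le (c q : R) : (0 <= c)%R -> (0 <= q)%R -> (q < 1)%R ->
  \sum_(0 <= k <oo) (c * q ^+ k)%:E <= (c / (1 - q))%:E.
Proof.
move=> c0 q0 q1; have q1' : (0 < 1 - q)%R by rewrite subr_gt0.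
apply: lime_le.
  by apply: is_cvg_nneseries => n _ _; rewrite lee_fin mulr_ge0// exprn_ge0.
near=> n; rewrite sumEFin lee_fin.
have := geometric_seriesE c (_ : q != 1%R).
rewrite lt_eqF// => /(_ isT).
move=> /(congr1 (fun u => u n)); rewrite /series /geometric /= => ->.
rewrite ler_pM2r ?invr_gt0// ler_piMr// lerBlDr lerDl exprn_ge0//.
Unshelve. all: by end_near.
Qed.

Context d (T : measurableType d) (mu : {measure set T -> \bar R}).

(** A series of functions with geometrically decreasing L^r (quasi-)norms, treated
    in the same way for r < 1 and r >= 1: if h_k = th^k U_k then the sum of the h_k is at
    most sup U_k / (1 - th), and (sup U_k)^r is at most the sum of the U_k^r. *)
Lemma quasi_norm_series (r th B : R) (h : T -> \bar R) (hk : nat -> T -> \bar R) :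
  (0 < r)%R -> (0 < th)%R -> (th < 1)%R -> (0 <= B)%R ->
  measurable_fun setT h -> (forall x, 0 <= h x) ->
  (forall k, measurable_fun setT (hk k)) -> (forall k x, 0 <= hk k x) ->
  (forall x, h x <= \sum_(0 <= k <oo) hk k x) ->
  (forall k, \int[mu]_x (hk k x `^ r) <= (B * (th ^+ k) `^ (2 * r))%:E) ->
  \int[mu]_x (h x `^ r) <= ((1 - th)^-1 `^ r * (B / (1 - th `^ r)))%:E.
Proof.
move=> r0 th0 th1 B0 mh h0 mhk hk0 hs hkB.
have th1' : (0 < 1 - th)%R by rewrite subr_gt0.
have thk k : (0 < th ^+ k)%R by rewrite exprn_gt0.
pose U k x := ((th ^+ k)^-1)%:E * hk k x.
have U0 k x : 0 <= U k x by rewrite mule_ge0// lee_fin invr_ge0 ltW.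
pose V x := \sum_(0 <= k <oo) (U k x `^ r).
have V0 x : 0 <= V x by apply: nneseries_ge0 => k _ _; exact: poweR_ge0.
have UV k x : U k x <= V x `^ r^-1.
  rewrite -[leLHS](poweRe1 (U0 _ _)) -(mulfV (lt0r_neq0 r0)) poweRrM.
  apply: le_poweR; rewrite ?invr_ge0 ?(ltW r0) ?poweR_ge0//.
  rewrite /V (@nneseriesD1 _ _ k)//; last by move=> j _; exact: poweR_ge0.
  by rewrite leeDl// nneseries_ge0// => j _ _; exact: poweR_ge0.
have hV x : h x <= ((1 - th)^-1)%:E * V x `^ r^-1.
  have := UV^~ x; set v := V x `^ r^-1 => Uv.
  have v0 : 0 <= v by exact: poweR_ge0.
  have [vfin|] := boolP (v \is a fin_num); last first.
    rewrite ge0_fin_numE// ltey negbK => /eqP ->.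
    by rewrite gt0_muley ?leey// lte_fin invr_gt0.
  apply: le_trans (hs x) _.
  rewrite -(fineK vfin) muleC -EFinM.
  apply: le_trans (nneseries_geometric_le _ _ th1); rewrite ?fine_ge0 ?(ltW th0)//.
  apply: lee_nneseries => [k _ _|k _]; first exact: hk0.
  by rewrite EFinM fineK// muleC -lee_pdivrMl//; exact: Uv.
have mU k : measurable_fun setT (fun x => U k x `^ r).
  by apply: (measurableT_comp (measurable_poweR r)); exact: measurable_funeM.
have mV : measurable_fun setT V.
  by apply: ge0_emeasurable_sum => // k x _ _; exact: poweR_ge0.
apply: le_trans (_ : \int[mu]_x (((1 - th)^-1 `^ r)%:E * V x) <= _).
  apply: ge0_le_integral => //.
  - by move=> x _; exact: poweR_ge0.
  - exact: (measurableT_comp (measurable_poweR r)).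
  - exact: measurable_funeM.
  move=> x _; apply: le_trans (le_poweR (ltW r0) (h0 x) (hV x)) _.
  rewrite poweRM ?poweR_ge0// ?lee_fin ?invr_ge0 ?(ltW th1')//.
  by rewrite poweR_EFin -poweRrM mulVf ?gt_eqF// poweRe1.
rewrite ge0_integralZl// ?lee_fin ?powR_ge0//.
rewrite EFinM lee_wpmul2l ?lee_fin ?powR_ge0//.
rewrite integral_nneseries//; last by move=> k x _; exact: poweR_ge0.
apply: le_trans (_ : \sum_(0 <= k <oo) (B * (th `^ r) ^+ k)%:E <= _); last first.
  apply: nneseries_geometric_le => //; first exact: powR_ge0.
  have r1 : (1 `^ r = 1 :> R)%R by rewrite powR1.
  rewrite -[ltRHS]r1.
  by rewrite gt0_ltr_powR// nnegrE ?ler01// ltW.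
apply: lee_nneseries => [k _ _|k _].
  by apply: integral_ge0 => x _; exact: poweR_ge0.
rewrite /U; under eq_integral.
  move=> x _; rewrite poweRM ?lee_fin ?invr_ge0 ?(ltW (thk k))// poweR_EFin. over.
rewrite ge0_integralZl//; last 3 first.
- exact: (measurableT_comp (measurable_poweR r)).
- by move=> x _; exact: poweR_ge0.
- by rewrite lee_fin powR_ge0.
apply: le_trans (_ : (((th ^+ k)^-1) `^ r)%:E * (B * (th ^+ k) `^ (2 * r))%:E <= _).
  by rewrite lee_wpmul2l ?lee_fin ?powR_ge0.
rewrite -EFinM lee_fin le_eqVlt; apply/orP; left; apply/eqP.
rewrite mulrCA; congr (_ * _)%R.
rewrite -powR_inv1 ?(ltW (thk k))// -powRrM -powRD; last first.
  by apply/implyP => _; rewrite gt_eqF.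
rewrite (_ : -1 * r + 2 * r = r)%R; last by ring.
by rewrite -(powR_mulrn k (ltW th0)) -(powR_mulrn k (powR_ge0 _ _)) -!powRrM mulrC.
Qed.

End GeometricSums.

(** * Decomposition into pieces *)

Lemma integral_cover_le d (T : measurableType d) (R : realType)
    (mu : {measure set T -> \bar R}) (D : set T) (I : nat -> set T) (h : T -> \bar R) :
  measurable D -> (forall k, measurable (I k)) -> D `<=` \bigcup_k I k ->
  measurable_fun setT h -> (forall x, (0 <= h x)%E) ->
  (\int[mu]_(x in D) h x <= \sum_(0 <= k <oo) \int[mu]_(x in I k) h x)%E.
Proof.
move=> mD mI DI mh h0.
have mhI k : measurable_fun setT (h \_ (I k)).
  by apply/(measurable_restrictT _ _).1 => //; exact: measurable_funTS.
have hI0 k x : (0 <= (h \_ (I k)) x)%E by rewrite patchE; case: ifP.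
under eq_eseriesr do rewrite integral_mkcond.
rewrite -integral_nneseries// integral_mkcond; apply: ge0_le_integral => //.
- by move=> x _; rewrite patchE; case: ifP.
- by apply/(measurable_restrictT _ _).1 => //; exact: measurable_funTS.
- by apply: ge0_emeasurable_sum.
move=> x _; rewrite patchE; case: ifPn => [/[1!inE]/DI[k _ Ikx]|_]; last first.
  exact: nneseries_ge0.
rewrite (@nneseriesD1 _ _ k)// patchE mem_set// leeDl//.
exact: nneseries_ge0.
Qed.

Section BoundedPieces.
Context {R : realType}.
Local Notation mu := (@lebesgue_measure R).
Local Open Scope ereal_scope.
Context (gam om : R -> R) (a b r : R).
Hypotheses (mgam : measurable_fun [set: R] gam) (mom : measurable_fun [set: R] om).
Hypotheses (om_ge0 : forall t, (0 <= om t)%R).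
Hypotheses (a_gt0 : (0 < a)%R) (b_gt0 : (0 < b)%R) (r_gt0 : (0 < r)%R).

Definition weighted_avg (D : set R) (F G : R -> R) (x : R) : \bar R :=
  \int[mu]_(t in D) (F (x - t) `^ a * G (x - gam t) `^ b * om t)%:E.

Definition mass_le1 (F : R -> R) : Prop :=
  [/\ measurable_fun [set: R] F, (forall t, 0 <= F t)%R & \int[mu]_t (F t)%:E <= 1].

(** The contribution of the parameters t in D to the operator is bounded; with
    F = |f|^p and G = |g|^q this is the L^p x L^q -> L^r bound. *)
Definition bounded_on (D : set R) : Prop := exists2 C : R, (0 <= C)%R &
  forall F G, mass_le1 F -> mass_le1 G ->
    \int[mu]_x (weighted_avg D F G x `^ r) <= C%:E.

Lemma weighted_avg_ge0 D F G x : 0 <= weighted_avg D F G x.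
Proof. by apply: integral_ge0 => t _; rewrite lee_fin !mulr_ge0 ?powR_ge0. Qed.

Let joint F G (z : R * R) : \bar R :=
  (F (z.1 - z.2) `^ a * G (z.1 - gam z.2) `^ b * om z.2)%:E.

Let measurable_wjoint F G : mass_le1 F -> mass_le1 G ->
  measurable_fun [set: R * R] (joint F G).
Proof.
move=> [mF _ _] [mG _ _].
have mFa : measurable_fun [set: R] (fun t => F t `^ a)%R.
  exact: (measurableT_comp (measurable_powR a) mF).
have mGb : measurable_fun [set: R] (fun t => G t `^ b)%R.
  exact: (measurableT_comp (measurable_powR b) mG).
have /measurable_EFinP H := measurable_joint mgam mFa mGb.
apply/measurable_EFinP; apply: measurable_funM; first exact: H.
exact: (measurableT_comp mom measurable_snd).
Qed.

Lemma measurable_weighted_section F G (x : R) : mass_le1 F -> mass_le1 G ->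
  measurable_fun [set: R] (fun t => (F (x - t) `^ a * G (x - gam t) `^ b * om t)%:E).
Proof.
move=> F1 G1; have := measurable_wjoint F1 G1 => mj.
exact: (measurableT_comp mj (measurable_pair1 x)).
Qed.

Lemma measurable_weighted_avg D F G : measurable D -> mass_le1 F -> mass_le1 G ->
  measurable_fun [set: R] (weighted_avg D F G).
Proof.
move=> mD F1 G1.
have := measurable_integral_section (T1 := measurableTypeR R) (T2 := measurableTypeR R)
  mu mD (measurable_wjoint F1 G1).
by apply => z; rewrite lee_fin !mulr_ge0 ?powR_ge0.
Qed.

Lemma weighted_avg_le D (W : R) F G x : measurable D -> (0 <= W)%R ->
  (forall t, D t -> om t <= W)%R -> mass_le1 F -> mass_le1 G ->
  weighted_avg D F G x <=
    W%:E * curve_avg gam D (fun t => F t `^ a)%R (fun t => G t `^ b)%R x.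
Proof.
move=> mD W0 omW F1 G1.
have [mF _ _] := F1; have [mG _ _] := G1.
have mP : measurable_fun D (fun t => (F (x - t) `^ a * G (x - gam t) `^ b)%:E).
  apply/measurable_EFinP/measurable_funTS; apply: measurable_funM.
    exact: (measurableT_comp (measurableT_comp (measurable_powR a) mF) (measurable_shift x)).
  exact: (measurableT_comp (measurableT_comp (measurable_powR b) mG)
    (measurable_shift_curve mgam x)).
rewrite /curve_avg -ge0_integralZl//; last first.
  by move=> t _; rewrite lee_fin mulr_ge0 ?powR_ge0.
apply: ge0_le_integral => //.
- by move=> t _; rewrite lee_fin !mulr_ge0 ?powR_ge0.
- by apply: measurable_funTS; exact: measurable_weighted_section.
- exact: measurable_funeM.
by move=> t Dt; rewrite -EFinM lee_fin mulrC ler_wpM2r ?mulr_ge0 ?powR_ge0 ?omW.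
Qed.

Lemma bounded_onU D1 D2 : measurable D1 -> measurable D2 ->
  bounded_on D1 -> bounded_on D2 -> bounded_on (D1 `|` D2).
Proof.
move=> mD1 mD2 [C1 C10 H1] [C2 C20 H2].
exists (2 `^ r * (C1 + C2))%R; first by rewrite mulr_ge0 ?powR_ge0// addr_ge0.
move=> F G F1 G1.
have m D : measurable D -> measurable_fun [set: R] (fun x => weighted_avg D F G x `^ r).
  move=> mD; apply: (measurableT_comp (measurable_poweR r)).
  exact: measurable_weighted_avg.
apply: le_trans (_ : \int[mu]_x ((2 `^ r)%:E *
    (weighted_avg D1 F G x `^ r + weighted_avg D2 F G x `^ r)) <= _); last first.
  rewrite ge0_integralZl//; last 2 first.
  - by apply: emeasurable_funD; exact: m.
  - by move=> x _; rewrite adde_ge0 ?poweR_ge0.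
  rewrite EFinM lee_wpmul2l ?lee_fin ?powR_ge0//.
  rewrite ge0_integralD//; try exact: m; try by move=> x _; exact: poweR_ge0.
  by rewrite EFinD; apply: leeD; [exact: H1|exact: H2].
apply: ge0_le_integral => //.
- by move=> x _; exact: poweR_ge0.
- by apply: m; exact: measurableU.
- by apply: measurable_funeM; apply: emeasurable_funD; exact: m.
move=> x _.
set M1 := weighted_avg D1 F G x; set M2 := weighted_avg D2 F G x.
have M10 : 0 <= M1 by exact: weighted_avg_ge0.
have M20 : 0 <= M2 by exact: weighted_avg_ge0.
have M12 : weighted_avg (D1 `|` D2) F G x <= M1 + M2.
  have := @integral_cover_le _ (measurableTypeR R) R mu (D1 `|` D2)
    (fun k => if k is 0%N then D1 else if k is 1%N then D2 else set0)
    (fun t => (F (x - t) `^ a * G (x - gam t) `^ b * om t)%:E).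
  rewrite (@nneseriesD1 _ _ 0%N)//; last first.
    by move=> k _; apply: integral_ge0 => t _; rewrite lee_fin !mulr_ge0 ?powR_ge0.
  rewrite (@nneseriesD1 _ _ 1%N)//; last first.
    by move=> k _; apply: integral_ge0 => t _; rewrite lee_fin !mulr_ge0 ?powR_ge0.
  rewrite [X in _ + (_ + X)]eseries0 ?adde0; last first.
    by move=> [|[|k]] _ //= _; rewrite integral_set0.
  apply.
  - exact: measurableU.
  - by move=> [|[|k]].
  - by move=> t [D1t|D2t]; [exists 0%N|exists 1%N].
  - exact: measurable_weighted_section.
  - by move=> t; rewrite lee_fin !mulr_ge0 ?powR_ge0.
apply: le_trans (le_poweR (ltW r_gt0) (weighted_avg_ge0 _ _ _ _) M12) _.
have half (N1 N2 : \bar R) : 0 <= N1 -> N1 <= N2 ->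
    (N1 + N2) `^ r <= (2 `^ r)%:E * N2 `^ r.
  move=> N10 N12; have N20 := le_trans N10 N12.
  rewrite -poweR_EFin -poweRM ?lee_fin//; apply: le_poweR; first exact: ltW.
    exact: adde_ge0.
  by rewrite [leRHS](_ : _ = N2 + N2) ?leeD2r// mule_natl mule2n.
have [M1M2|/ltW M2M1] := leP M1 M2.
  apply: le_trans (half _ _ M10 M1M2) _.
  by rewrite lee_wpmul2l ?lee_fin ?powR_ge0// leeDr// poweR_ge0.
rewrite addeC; apply: le_trans (half _ _ M20 M2M1) _.
by rewrite lee_wpmul2l ?lee_fin ?powR_ge0// leeDl// poweR_ge0.
Qed.

Context (w a' b' : R).
Hypotheses (w_gt0 : (0 < w)%R).
Hypotheses (w_ge : (a + b - 1 <= w)%R) (a'_ge0 : (0 <= a')%R) (b'_ge0 : (0 <= b')%R).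
Hypotheses (a'_le : (a' <= a - w)%R) (b'_le : (b' <= b - w)%R).
Hypotheses (ab'_le : (a' + b' + w <= r^-1)%R) (ab_ge : (1 <= r * (a + b))%R).

(** The reduction on which the three regimes rest: it suffices to cover D by pieces
    whose norms, times the size W of the weight, decrease geometrically. *)
Lemma bounded_on_pieces (D : set R) (I : nat -> set R) (l lam J L c d W : nat -> R) (K th : R) :
  measurable D -> D `<=` \bigcup_k I k ->
  (0 < th)%R -> (th < 1)%R -> (0 <= K)%R ->
  (forall k, [/\ measurable (I k), (0 <= W k)%R & (forall t, I k t -> om t <= W k)%R]) ->
  (forall k, [/\ (0 < l k)%R, (0 < lam k)%R, (0 < J k)%R, (l k <= L k)%R &
     (lam k * l k <= L k)%R]) ->
  (forall k t, I k t -> (c k <= t <= c k + l k)%R /\ (d k <= gam t <= d k + L k)%R) ->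
  (forall k s t, I k s -> I k t -> (lam k * `|t - s| <= `|gam t - gam s|)%R /\
     (J k * `|t - s| <= `|(t - gam t) - (s - gam s)|)%R) ->
  (forall k, W k * piece_norm a b r w a' b' (l k) (lam k) (J k) (L k) <=
     K * (th ^+ k) ^+ 2)%R ->
  bounded_on D.
Proof.
move=> mD DI th0 th1 K0 IW pos win expand WN.
pose B0 := (4 * (piece_const a b r w * 3 `^ (r * (a + b))))%R.
have B00 : (0 <= B0)%R by rewrite !mulr_ge0 ?powR_ge0.
pose B := (B0 * K `^ r)%R.
have B_ge0 : (0 <= B)%R by rewrite mulr_ge0 ?powR_ge0.
exists ((1 - th)^-1 `^ r * (B / (1 - th `^ r)))%R.
  rewrite !mulr_ge0 ?powR_ge0// invr_ge0 subr_ge0.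
  have r1 : (1 `^ r = 1 :> R)%R by rewrite powR1.
  by rewrite -[leRHS]r1 ge0_ler_powR// ?nnegrE ?ltW.
move=> F G F1 G1; have [mF F0 F1'] := F1; have [mG G0 G1'] := G1.
apply: (@quasi_norm_series R _ (measurableTypeR R) mu r th B (weighted_avg D F G)
  (fun k => weighted_avg (I k) F G)) => //.
- exact: measurable_weighted_avg.
- by move=> x; exact: weighted_avg_ge0.
- by move=> k; apply: measurable_weighted_avg => //; have [] := IW k.
- by move=> k x; exact: weighted_avg_ge0.
- move=> x; apply: (@integral_cover_le _ (measurableTypeR R)) => //.
  + by move=> k; have [] := IW k.
  + exact: measurable_weighted_section.
  + by move=> t; rewrite lee_fin !mulr_ge0 ?powR_ge0.
move=> k; have [mIk Wk0 omW] := IW k; have [l0 lam0 J0 lL lamlL] := pos k.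
set M := curve_avg gam (I k) (fun t => F t `^ a)%R (fun t => G t `^ b)%R.
have M0 x : 0 <= M x by apply: curve_avg_ge0 => t; exact: powR_ge0.
have mM : measurable_fun [set: R] M.
  apply: measurable_curve_avg => //; try by move=> t; exact: powR_ge0.
  - exact: (measurableT_comp (measurable_powR a) mF).
  - exact: (measurableT_comp (measurable_powR b) mG).
have mMr : measurable_fun [set: R] (fun x => M x `^ r).
  exact: (measurableT_comp (measurable_poweR r)).
apply: le_trans (_ : \int[mu]_x ((W k `^ r)%:E * M x `^ r) <= _).
  apply: ge0_le_integral => //.
  - by move=> x _; exact: poweR_ge0.
  - apply: (measurableT_comp (measurable_poweR r)).
    exact: measurable_weighted_avg.
  - exact: measurable_funeM.
  move=> x _; rewrite -poweR_EFin -poweRM ?lee_fin//; apply: le_poweR.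
  - exact: ltW.
  - exact: weighted_avg_ge0.
  - exact: weighted_avg_le.
rewrite ge0_integralZl//; last 2 first.
- by move=> x _; exact: poweR_ge0.
- by rewrite lee_fin powR_ge0.
set N := piece_norm a b r w a' b' (l k) (lam k) (J k) (L k).
have N0 : (0 <= N)%R by rewrite /N /piece_norm !mulr_ge0 ?powR_ge0.
apply: le_trans (_ : (W k `^ r)%:E * (B0 * N `^ r)%:E <= _).
  rewrite lee_wpmul2l ?lee_fin ?powR_ge0//.
  have := @piece_estimate R gam mgam a b r w a' b' a_gt0 b_gt0 r_gt0 w_gt0 w_ge a'_ge0
    b'_ge0 a'_le b'_le ab'_le ab_ge (I k) (l k) (lam k) (J k) (L k) (c k) (d k) mIk
    l0 lam0 J0 lL lamlL.
  rewrite (_ : B0 * N `^ r = 4 * (piece_const a b r w * N `^ r * 3 `^ (r * (a + b))))%R.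
    apply => //.
    + by move=> t /win[].
    + by move=> t /win[].
    + by move=> s t Is It; have [] := expand _ _ _ Is It.
    + by move=> s t Is It; have [] := expand _ _ _ Is It.
  by rewrite /B0; ring.
rewrite -EFinM lee_fin /B mulrCA -mulrA ler_wpM2l// -powRM//.
rewrite powRrM -powRM ?powR_ge0//.
apply: ge0_ler_powR; rewrite ?nnegrE ?mulr_ge0 ?powR_ge0 ?(ltW r_gt0)//.
by rewrite powR_mulrn ?WN// exprn_ge0// ltW.
Qed.

End BoundedPieces.

(** * Geometry of the curve *)

Section FilterBounds.
Context {R : realType}.

Lemma limf_esup_lt_near (T : choiceType) (X : filteredType T) (f : X -> \bar R)
    (F : set_system X) {FF : Filter F} (c : \bar R) :
  (limf_esup f F < c)%E -> \forall x \near F, (f x < c)%E.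
Proof.
rewrite limf_esupE => /ereal_inf_lt[_ [V FV <-] Vc].
by apply: filterS FV => x Vx; apply: le_lt_trans Vc; apply: ereal_sup_ubound; exists x.
Qed.

Lemma limf_einf_gt_near (T : choiceType) (X : filteredType T) (f : X -> \bar R)
    (F : set_system X) {FF : Filter F} (c : \bar R) :
  (c < limf_einf f F)%E -> \forall x \near F, (c < f x)%E.
Proof.
rewrite limf_einfE => /ereal_sup_gt[_ [V FV <-] Vc].
by apply: filterS FV => x Vx; apply: lt_le_trans Vc _; apply: ereal_inf_lbound; exists x.
Qed.

Lemma limf_einf_le_esup (T : choiceType) (X : filteredType T) (f : X -> \bar R)
    (F : set_system X) {FF : ProperFilter F} :
  (limf_einf f F <= limf_esup f F)%E.
Proof.
rewrite limf_einfE limf_esupE; apply: ge_ereal_sup => _ [V FV <-].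
apply: le_ereal_inf_tmp => _ [W FW <-].
have [x [Vx Wx]] := filter_ex (filterI FV FW).
by apply: (@le_trans _ _ (f x)); [apply: ereal_inf_lbound|apply: ereal_sup_ubound]; exists x.
Qed.

Lemma near0_right (P : R -> Prop) : (\forall t \near 0^'+, P t) ->
  exists2 d : R, 0 < d & forall t, 0 < t -> t < d -> P t.
Proof.
move=> /nbhs_ballP[d /= d0 dP]; exists d => // t t0 td; apply: dP => //=.
by rewrite /ball/= sub0r normrN gtr0_norm.
Qed.

Lemma near_pinfty (P : R -> Prop) : (\forall t \near +oo, P t) ->
  exists2 N : R, 0 < N & forall t, N < t -> P t.
Proof.
move=> [N [_ NP]]; exists (Num.max N 1); first by rewrite lt_max ltr01 orbT.
by move=> t; rewrite gt_max => /andP[Nt _]; exact: NP.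
Qed.

End FilterBounds.

Section MeanValue.
Context {R : realType} (f : R -> R).
Hypothesis df : forall t, 0 < t -> derivable f t 1.

Lemma within_continuous_pos (s t : R) : 0 < s -> {within `[s, t], continuous f}.
Proof.
move=> s0; apply: derivable_within_continuous => x; rewrite in_itv/= => /andP[sx _].
by apply: df; exact: lt_le_trans sx.
Qed.

Lemma mvt_pos (s t : R) : 0 < s -> s <= t ->
  exists xi, s <= xi <= t /\ f t - f s = derive1 f xi * (t - s).
Proof.
move=> s0 st; have [x|xi] := MVT_segment (df := derive1 f) st _ (within_continuous_pos s0).
  rewrite in_itv/= => /andP[sx _]; rewrite derive1E.
  by apply: derivableP; apply: df; exact: lt_trans sx.
by rewrite in_itv/= => xist E; exists xi.
Qed.

Definition order_convex (I : set R) :=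
  forall s t xi, I s -> I t -> s <= xi -> xi <= t -> I xi.

Lemma order_convex_segment (s t : R) : order_convex [set u | s <= u <= t].
Proof.
move=> u v xi /andP[su _] /andP[_ vt] uxi xiv.
by apply/andP; split; [exact: le_trans uxi|exact: le_trans vt].
Qed.
Lemma mvt_expand (I : set R) (k : R) : order_convex I -> (forall t, I t -> 0 < t) ->
  (forall t, I t -> k <= `|derive1 f t|) ->
  forall s t, I s -> I t -> k * `|t - s| <= `|f t - f s|.
Proof.
move=> cI I0 Ik s t Is It; wlog st : s t Is It / s <= t.
  move=> H; have [st|/ltW ts] := leP s t; first exact: H.
  by rewrite distrC [leRHS]distrC; exact: H.
have [xi [/andP[sxi xit] ->]] := mvt_pos (I0 _ Is) st.
by rewrite normrM ler_wpM2r// Ik//; exact: cI sxi xit.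
Qed.

Lemma mvt_lipschitz (I : set R) (k : R) : order_convex I -> (forall t, I t -> 0 < t) ->
  (forall t, I t -> `|derive1 f t| <= k) ->
  forall s t, I s -> I t -> `|f t - f s| <= k * `|t - s|.
Proof.
move=> cI I0 Ik s t Is It; wlog st : s t Is It / s <= t.
  move=> H; have [st|/ltW ts] := leP s t; first exact: H.
  by rewrite distrC [X in _ <= _ * X]distrC; exact: H.
have [xi [/andP[sxi xit] ->]] := mvt_pos (I0 _ Is) st.
by rewrite normrM ler_wpM2r// Ik//; exact: cI sxi xit.
Qed.

End MeanValue.

Section CurveFacts.
Context {R : realType} (gamma : R -> R) (c1 c2 C : R).
Hypotheses (gamma_C2 : C2_pos gamma) (gamma_mono : monotonic_pos gamma).
Hypothesis gamma_lim0 : gamma t @[t --> 0^'+] --> (0 : R).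
Hypothesis dgamma_lim0 : derive1 gamma t @[t --> 0^'+] --> (0 : R).
Hypotheses (c1_gt0 : 0 < c1) (c2_gt0 : 0 < c2) (C_gt0 : 0 < C).
Hypothesis bounds : forall t : R, 0 < t ->
  [/\ `|t * derive1 gamma t / gamma t| <= C,
      c1 <= `|t * derive1 gamma t / gamma t|
    & c2 <= `|t ^+ 2 * derive1n 2 gamma t / gamma t|].

Lemma curve_derivable t : 0 < t -> derivable gamma t 1.
Proof. by move=> /gamma_C2[]. Qed.

Lemma dcurve_derivable t : 0 < t -> derivable (derive1 gamma) t 1.
Proof. by move=> /gamma_C2[]. Qed.

Lemma curve_neq0 t : 0 < t -> gamma t != 0.
Proof.
move=> t0; apply/eqP => g0; have [_ + _] := bounds t0.
by rewrite g0 invr0 mulr0 normr0 leNgt c1_gt0.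
Qed.

Lemma curve_norm_gt0 t : 0 < t -> 0 < `|gamma t|.
Proof. by move=> t0; rewrite normr_gt0 curve_neq0. Qed.

Lemma dcurve_ge t : 0 < t -> c1 * `|gamma t| <= t * `|derive1 gamma t|.
Proof.
move=> t0; have [_ + _] := bounds t0; rewrite normrM normfV ler_pdivlMr ?curve_norm_gt0//.
by rewrite normrM (gtr0_norm t0).
Qed.

Lemma dcurve_le t : 0 < t -> t * `|derive1 gamma t| <= C * `|gamma t|.
Proof.
move=> t0; have [+ _ _] := bounds t0; rewrite normrM normfV ler_pdivrMr ?curve_norm_gt0//.
by rewrite normrM (gtr0_norm t0).
Qed.

Lemma ddcurve_ge t : 0 < t -> c2 * `|gamma t| <= t ^+ 2 * `|derive1 (derive1 gamma) t|.
Proof.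
move=> t0; have [_ _ +] := bounds t0; rewrite normrM normfV ler_pdivlMr ?curve_norm_gt0//.
by rewrite normrM (ger0_norm (exprn_ge0 _ (ltW t0))).
Qed.

Lemma dcurve_neq0 t : 0 < t -> derive1 gamma t != 0.
Proof.
move=> t0; apply/eqP => g0; have := dcurve_ge t0.
by rewrite g0 normr0 mulr0 leNgt mulr_gt0// curve_norm_gt0.
Qed.

Lemma dcurve_continuous s t : 0 < s -> {within `[s, t], continuous (derive1 gamma)}.
Proof. by apply: within_continuous_pos => u; exact: dcurve_derivable. Qed.

Lemma dcurve_same_sign s t : 0 < s -> s <= t -> 0 < derive1 gamma s * derive1 gamma t.
Proof.
move=> s0 st; rewrite ltNge; apply/negP => neg.
have [|xi] := IVT (v := 0) st (dcurve_continuous s0).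
  by rewrite ge_min le_max; move: neg; case: (ltgtP (derive1 gamma s) 0) => s_;
     case: (ltgtP (derive1 gamma t) 0) => t_ //=; nra.
rewrite in_itv/= => /andP[sxi _] /eqP; apply/negP; apply: dcurve_neq0.
exact: lt_le_trans sxi.
Qed.

Lemma near0_small (f : R -> R) e : f t @[t --> 0^'+] --> (0 : R) -> 0 < e ->
  exists2 d : R, 0 < d & forall t, 0 < t -> t < d -> `|f t| < e.
Proof. by move=> f0 e0; apply: near0_right; exact: cvgr0_norm_lt. Qed.

(** The derivative has no zero, hence constant sign by the intermediate value theorem;
    the sign of gamma is fixed by monotonicity and by its limit at 0. *)
Lemma curve_sign : exists sg : R, [/\ sg = 1 \/ sg = -1,
  (forall t, 0 < t -> 0 < sg * gamma t) & (forall t, 0 < t -> 0 < sg * derive1 gamma t)].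
Proof.
have key (sg : R) : sg = 1 \/ sg = -1 ->
    (forall s t, 0 < s -> s <= t -> sg * gamma s <= sg * gamma t) ->
    [/\ sg = 1 \/ sg = -1,
      (forall t, 0 < t -> 0 < sg * gamma t) & (forall t, 0 < t -> 0 < sg * derive1 gamma t)].
  move=> sgE mono; have sg2 : sg * sg = 1 by case: sgE => ->; rewrite ?mul1r ?mulrNN ?mul1r.
  have sgn x : `|sg * x| = `|x| by rewrite normrM; case: sgE => ->; rewrite ?normrN normr1 mul1r.
  split => // t t0.
    rewrite lt_neqAle eq_sym mulf_neq0 ?curve_neq0 ?andbT//=; last first.
      by apply/eqP => sg0; move: sg2; rewrite sg0 mul0r => /eqP; rewrite eq_sym oner_eq0.
    rewrite leNgt; apply/negP => gt0.
    have e0 : 0 < - (sg * gamma t) by rewrite oppr_gt0.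
    have [d d0 dP] := near0_small gamma_lim0 e0.
    pose s := Num.min (d / 2) t.
    have s0 : 0 < s by rewrite lt_min t0 divr_gt0.
    have sd : s < d by rewrite gt_min; apply/orP; left; lra.
    have st : s <= t by rewrite ge_min lexx orbT.
    have := dP _ s0 sd; have := mono _ _ s0 st; rewrite -sgn.
    by rewrite ltr_norml => ? /andP[]; lra.
  have t2 : t <= t + t by lra.
  have [xi [/andP[txi _] E]] := mvt_pos curve_derivable t0 t2.
  have dxi : 0 <= sg * derive1 gamma xi.
    have := mono _ _ t0 t2; rewrite -subr_ge0 -mulrBr E addrK mulrA pmulr_lge0//.
  have := dcurve_same_sign t0 txi.
  have -> : derive1 gamma t * derive1 gamma xi = (sg * derive1 gamma t) * (sg * derive1 gamma xi).
    by rewrite mulrACA sg2 mul1r.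
  move=> H; rewrite ltNge; apply/negP => neg; move: H; rewrite ltNge.
  by rewrite mulr_le0_ge0.
case: gamma_mono => mono; [exists 1|exists (-1)]; apply: key; [by left| |by right|].
  move=> s t s0 st; rewrite !mul1r; apply: mono => //; rewrite inE/= in_itv/= andbT//.
  exact: lt_le_trans st.
move=> s t s0 st; rewrite !mulN1r lerN2; apply: mono => //; rewrite inE/= in_itv/= andbT//.
exact: lt_le_trans st.
Qed.

Lemma curve_norm_mono s t : 0 < s -> s <= t -> `|gamma s| <= `|gamma t|.
Proof.
move=> s0 st; have t0 : 0 < t by exact: lt_le_trans st.
have [sg [sgE sg0 dsg0]] := curve_sign.
have sgn x : `|sg * x| = `|x| by rewrite normrM; case: sgE => ->; rewrite ?normrN normr1 mul1r.
rewrite -[leLHS]sgn -[leRHS]sgn !gtr0_norm ?sg0//.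
have [xi [/andP[sxi _] E]] := mvt_pos curve_derivable s0 st.
rewrite -subr_ge0 -mulrBr E mulrA mulr_ge0 ?subr_ge0//.
by rewrite ltW// dsg0// (lt_le_trans s0).
Qed.

(** The mean value theorem for ln |gamma|, whose derivative at t is at most C / t. *)
Lemma curve_doubling t : 0 < t -> `|gamma (2 * t)| <= expR C * `|gamma t|.
Proof.
move=> t0; have [sg [sgE sg0 dsg0]] := curve_sign.
have sgn x : `|sg * x| = `|x| by rewrite normrM; case: sgE => ->; rewrite ?normrN normr1 mul1r.
have t2 : t <= 2 * t by lra.
have t20 : 0 < 2 * t by lra.
pose f u := ln (sg * gamma u).
have isd (u : R) : 0 < u -> is_derive u 1 f (derive1 gamma u / gamma u).
  move=> u0.
  have isg : is_derive u 1 (sg \*: gamma) (sg *: derive1 gamma u).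
    apply: is_deriveZ; rewrite derive1E.
    exact: derivableP (curve_derivable u0).
  have isl : is_derive (sg * gamma u) 1 (@ln R) (sg * gamma u)^-1.
    exact: is_derive1_ln (sg0 _ u0).
  have := @is_derive1_comp R (@ln R) (sg \*: gamma) u _ _ isl isg.
  have g0 := curve_neq0 u0.
  move=> H; rewrite (_ : _ / _ = (sg * gamma u)^-1 * (sg *: derive1 gamma u)).
    exact: H.
  by rewrite /GRing.scale/=; case: sgE => ->; field.
have [x| |xi] := MVT_segment (df := fun u => derive1 gamma u / gamma u) t2 (f := f).
- by rewrite in_itv/= => /andP[tx _]; apply: isd; exact: lt_trans tx.
- apply: derivable_within_continuous => x; rewrite in_itv/= => /andP[tx _].
  by apply: ex_derive; apply: isd; exact: lt_le_trans tx.
rewrite in_itv/= => /andP[txi _] E.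
have xi0 : 0 < xi by exact: lt_le_trans txi.
have le1 : f (2 * t) - f t <= C.
  rewrite E (_ : 2 * t - t = t); last by ring.
  apply: le_trans (ler_norm _) _; rewrite normrM normrM normfV (gtr0_norm t0).
  rewrite mulrAC ler_pdivrMr ?curve_norm_gt0//.
  apply: le_trans (dcurve_le xi0); rewrite mulrC.
  by rewrite ler_wpM2r.
rewrite -[leLHS]sgn -[X in _ <= _ * X]sgn !gtr0_norm ?sg0//.
rewrite -[leLHS]lnK ?posrE ?sg0// -[X in _ <= _ * X]lnK ?posrE ?sg0//.
by rewrite -expRD ler_expR; rewrite /f in le1; lra.
Qed.

(** If gamma increases, its derivative goes from values below 1 to values above 1, so
    it takes the value 1 at some t0, and it moves away from 1 at least linearly since
    the second derivative does not vanish.  If gamma decreases, the derivative is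
    negative and any t0 will do. *)
Lemma dcurve_cross : (exists2 N, 0 < N & 1 < `|derive1 gamma N|) ->
  exists2 t0, 0 < t0 & forall del N, 0 < del -> del <= t0 -> t0 <= N ->
    exists2 k, 0 < k & forall t, del <= t -> t <= N ->
      k * `|t - t0| <= `|1 - derive1 gamma t|.
Proof.
move=> [N1 N10 gN1]; have [sg [sgE sg0 dsg0]] := curve_sign.
case: sgE => sgE; subst sg; last first.
  exists 1 => // del N del0 del1 N1'.
  exists (N + 1)^-1; first by rewrite invr_gt0; lra.
  move=> t delt tN; have t0 : 0 < t by exact: lt_le_trans delt.
  have dg := dsg0 _ t0.
  have : 1 <= `|1 - derive1 gamma t| by rewrite ger0_norm; lra.
  apply: le_trans; rewrite mulrC ler_pdivrMr; last by lra.
  by rewrite ler_norml; lra.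
have [d d0 dP] := near0_small dgamma_lim0 ltr01.
pose s := Num.min (d / 2) N1.
have s0 : 0 < s by rewrite lt_min N10 divr_gt0.
have sd : s < d by rewrite gt_min; apply/orP; left; lra.
have sN : s <= N1 by rewrite ge_min lexx orbT.
have gs := dP _ s0 sd.
have dgs := dsg0 _ s0; have dgN := dsg0 _ N10.
have [|t0] := IVT (v := 1) sN (dcurve_continuous s0).
  move: gs gN1; rewrite !gtr0_norm; [|lra|lra] => gs gN1.
  by rewrite ge_min le_max (ltW gs) (ltW gN1) orbT.
rewrite in_itv/= => /andP[st0 _] gt0.
have t00 : 0 < t0 by exact: lt_le_trans st0.
exists t0 => // del N del0 delt0 t0N.
have N0 : 0 < N by exact: lt_le_trans t0N.
exists (c2 * `|gamma del| / N ^+ 2).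
  by rewrite divr_gt0 ?mulr_gt0 ?curve_norm_gt0 ?exprn_gt0.
move=> t delt tN; rewrite -gt0 [leRHS]distrC.
pose I := [set u : R | del <= u <= N].
apply: (@mvt_expand _ (derive1 gamma) dcurve_derivable I).
- move=> u v xi /andP[? ?] /andP[? ?] ? ?; apply/andP; split; lra.
- by move=> u /andP[? ?]; lra.
- move=> u /andP[du uN]; have u0 : 0 < u by exact: lt_le_trans du.
  rewrite ler_pdivrMr ?exprn_gt0//.
  apply: le_trans (_ : c2 * `|gamma u| <= _).
    by rewrite ler_pM2l// curve_norm_mono.
  apply: le_trans (ddcurve_ge u0) _; rewrite mulrC ler_wpM2l//.
  by rewrite lerXn2r// nnegrE ltW.
- by rewrite /I/=; apply/andP.
- by rewrite /I/=; apply/andP.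
Qed.

Lemma curve_growth0 (e w : R) : 0 < e -> omega02 gamma = w%:E ->
  exists2 d : R, 0 < d & forall t, 0 < t -> t < d -> t `^ (w + e) <= `|gamma t|.
Proof.
move=> e0 wE.
have : (omega02 gamma < (w + e)%:E)%E by rewrite wE lte_fin ltrDl.
move=> /limf_esup_lt_near/near0_right[d d0 dP].
exists (Num.min d 1); first by rewrite lt_min d0 ltr01.
move=> t t0; rewrite lt_min => /andP[td t1].
have := dP _ t0 td; rewrite /log_ratio lte_fin ltr_ndivrMr ?ln_lt0 ?t0// => H.
rewrite /powR gt_eqF// -[leRHS]lnK ?posrE ?curve_norm_gt0// ler_expR.
exact: ltW.
Qed.

Lemma curve_growthoo (e w : R) : 0 < e -> omegaoo1 gamma = w%:E ->
  exists2 N : R, 0 < N & forall t, N < t -> t `^ (w - e) <= `|gamma t|.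
Proof.
move=> e0 wE.
have : ((w - e)%:E < omegaoo1 gamma)%E by rewrite wE lte_fin ltrBlDr ltrDl.
move=> /limf_einf_gt_near/near_pinfty[d d0 dP].
exists (Num.max d 1); first by rewrite lt_max d0.
move=> t; rewrite gt_max => /andP[td t1]; have t0 : 0 < t by lra.
have := dP _ td; rewrite /log_ratio lte_fin ltr_pdivlMr ?ln_gt0// => H.
rewrite /powR gt_eqF// -[leRHS]lnK ?posrE ?curve_norm_gt0// ler_expR.
exact: ltW.
Qed.

End CurveFacts.

(** * Small, large and intermediate parameters *)

Section Dyadic.
Context {R : realType}.

Lemma dyadic_bracket (x : R) : 0 < x -> x <= 1 ->
  exists k : nat, 2^-1 ^+ k / 2 <= x /\ x <= 2^-1 ^+ k.
Proof.
move=> x0 x1.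
have ex : exists k : nat, 2^-1 ^+ k.+1 <= x.
  exists (Num.bound x^-1); apply: ltW.
  have xb : x^-1 < (Num.bound x^-1)%:R by rewrite archi_boundP// invr_ge0 ltW.
  rewrite exprVn -[ltRHS]invrK ltf_pV2 ?posrE ?exprn_gt0 ?invr_gt0//.
  apply: lt_trans xb _; rewrite -natrX ltr_nat.
  by apply: leq_ltn_trans (leqnSn _) _; exact: ltn_expl.
exists (ex_minn ex); case: ex_minnP => k kx kmin; split; first by rewrite -exprSr.
case: k kx kmin => [|k] kx kmin; first by rewrite expr0.
by rewrite leNgt; apply/negP => /ltW/kmin; rewrite ltnn.
Qed.

Lemma scale_powR_geometric (c q ka : R) (k : nat) : 0 < c -> 0 < q ->
  (c * q ^+ k) `^ ka = c `^ ka * ((q `^ (ka / 2)) ^+ k) ^+ 2.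
Proof.
move=> c0 q0; have q0' := ltW q0; have qk0 : 0 <= q ^+ k by exact: exprn_ge0.
rewrite (powRM _ (ltW c0) qk0) -exprM; congr (_ * _).
rewrite -(powR_mulrn _ q0') -(powR_mulrn (k * 2) (powR_ge0 _ _)) -!powRrM natrM.
by congr (_ `^ _); field.
Qed.

End Dyadic.

Section Regimes.
Context {R : realType} (gamma : R -> R) (c1 c2 C : R).
Hypotheses (gamma_C2 : C2_pos gamma) (gamma_mono : monotonic_pos gamma).
Hypothesis gamma_lim0 : gamma t @[t --> 0^'+] --> (0 : R).
Hypothesis dgamma_lim0 : derive1 gamma t @[t --> 0^'+] --> (0 : R).
Hypotheses (c1_gt0 : 0 < c1) (c2_gt0 : 0 < c2) (C_gt0 : 0 < C).
Hypothesis bounds : forall t : R, 0 < t ->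
  [/\ `|t * derive1 gamma t / gamma t| <= C,
      c1 <= `|t * derive1 gamma t / gamma t|
    & c2 <= `|t ^+ 2 * derive1n 2 gamma t / gamma t|].

(** Only the values of the curve on the open half-line matter; extending it by 0 makes
    it measurable on R. *)
Definition curve0 : R -> R := gamma \_ `]0, +oo[.
Definition weight (alpha : R) : R -> R := fun t => (t `^ (1 - alpha))^-1.

Lemma curve0E t : 0 < t -> curve0 t = gamma t.
Proof. by move=> t0; rewrite /curve0 patchE mem_set//= in_itv/= t0. Qed.

Lemma measurable_curve0 : measurable_fun [set: R] curve0.
Proof.
apply/(measurable_restrictT _ _).1; first exact: measurable_itv.
apply: open_continuous_measurable_fun; first exact: interval_open.
move=> t; rewrite inE/= in_itv/= andbT => /(curve_derivable gamma_C2)/derivable1_diffP.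
exact: differentiable_continuous.
Qed.

Lemma measurable_weight alpha : measurable_fun [set: R] (weight alpha).
Proof.
rewrite (_ : weight alpha = fun t => t `^ (alpha - 1)); first exact: measurable_powR.
by apply/funext => t; rewrite /weight -powRN opprB.
Qed.

Lemma weight_ge0 alpha t : 0 <= weight alpha t.
Proof. by rewrite invr_ge0 powR_ge0. Qed.

Lemma weight_le alpha T t : alpha < 1 -> 0 < T -> T <= t -> weight alpha t <= T `^ (alpha - 1).
Proof.
move=> al1 T0 Tt; have t0 : 0 < t by exact: lt_le_trans Tt.
have -> : T `^ (alpha - 1) = (T `^ (1 - alpha))^-1 by rewrite -powRN opprB.
rewrite /weight lef_pV2 ?posrE ?powR_gt0//.
by apply: ge0_ler_powR => //; rewrite ?nnegrE ?subr_ge0 ltW.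
Qed.

Lemma derive1_idB u : 0 < u -> derive1 (fun v => v - gamma v) u = 1 - derive1 gamma u.
Proof.
move=> u0; rewrite !derive1E deriveB//; last exact: curve_derivable.
by rewrite derive_id.
Qed.
Context (alpha a b r w : R).
Hypotheses (alpha_lt1 : alpha < 1) (a_gt0 : 0 < a) (b_gt0 : 0 < b) (r_gt0 : 0 < r).
Hypotheses (w_gt0 : 0 < w) (w_ge : a + b - 1 <= w) (w_lea : w <= a) (w_leb : w <= b)
  (w_lez : w <= r^-1) (ab_ge : 1 <= r * (a + b)).
Local Notation z := (r^-1).
Local Notation bounded := (bounded_on curve0 (weight alpha) a b r).

Lemma bounded_on_set1 t0 : bounded [set t0].
Proof.
exists 0 => // F G F1 G1.
have [mF F0 _] := F1; have [mG G0 _] := G1.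
have avg0 x : weighted_avg curve0 (weight alpha) a b [set t0] F G x = 0%E.
  apply: null_set_integral; [exact: measurable_set1| |exact: lebesgue_measure_set1].
  apply: measurable_funTS.
  exact: (measurable_weighted_section _ _ measurable_curve0 (measurable_weight alpha) x F1 G1).
by under eq_integral do rewrite avg0 poweR0r ?gt_eqF//; rewrite integral0.
Qed.

Lemma piece_norm_powR (a' b' T l lam J L : R) (e1 e2 e3 : R) :
  0 < T -> 0 < l -> 0 < lam -> 0 < J -> 0 < L ->
  piece_norm a b r w a' b' (l * T) (lam * T `^ e1) (J * T `^ e2) (L * T `^ e3) =
  piece_norm a b r w a' b' l lam J L *
  T `^ ((1 - a - b + w + a' + b') - e1 * (b - w - b') - e2 * w + e3 * (z - a' - b' - w)).
Proof.
move=> T0 l0 lam0 J0 L0; rewrite /piece_norm !powRM ?powR_ge0 ?ltW// -!powRrM.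
have tn : T != 0 by rewrite gt_eqF.
have pD x y : T `^ (x + y) = T `^ x * T `^ y by rewrite powRD// tn implybT.
rewrite -[e2 * w]opprK -[e1 * (b - w - b')]opprK -!mulrN !opprK !pD; ring.
Qed.

Lemma piece_norm_powR2 (a' b' T rho l lam J L : R) :
  0 < T -> 0 < rho -> 0 < l -> 0 < lam -> 0 < J -> 0 < L ->
  piece_norm a b r w a' b' (l * T) (lam * rho) (J * rho) (L * (T * rho)) =
  piece_norm a b r w a' b' l lam J L *
  (T `^ ((1 - a - b + w + a' + b') + (z - a' - b' - w)) *
   rho `^ (- (b - w - b') - w + (z - a' - b' - w))).
Proof.
move=> T0 rho0 l0 lam0 J0 L0; rewrite /piece_norm !powRM ?mulr_ge0 ?powR_ge0 ?ltW//.
have tn : T != 0 by rewrite gt_eqF.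
have rn : rho != 0 by rewrite gt_eqF.
have pD x y : T `^ (x + y) = T `^ x * T `^ y by rewrite powRD// tn implybT.
have rD x y : rho `^ (x + y) = rho `^ x * rho `^ y by rewrite powRD// rn implybT.
rewrite [T `^ (_ + (z - _ - _ - w))]pD [rho `^ (_ + (z - _ - _ - w))]rD.
rewrite [rho `^ (- _ - w)]rD; ring.
Qed.

(** On [T/2, T] with T = T0 2^-k the derivative is at least of order T^(w2 + eps - 1) and
    at most 1/2, so t - gamma t expands by 1/2 and gamma(I) is not longer than I.  Here
    the L^1 bound is used for the average of G as much as possible, as the sup bound
    is costly when the derivative is small. *)
Lemma bounded_small (w2 eps : R) : 1 < w2 -> 0 < eps -> omega02 gamma = w2%:E ->
  0 < alpha - (a + b - z) - (w2 + eps - 1) * (b - Num.min b z) ->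
  exists2 d : R, 0 < d & forall T, 0 < T -> T < d -> bounded `]0, T].
Proof.
move=> w21 eps0 w2E kap.
have half0 : (0 : R) < 1 / 2 by lra.
have [d1 d10 dsmall] := near0_small dgamma_lim0 half0.
have [d2 d20 growth] := curve_growth0 c1_gt0 bounds eps0 w2E.
exists (Num.min d1 d2); first by rewrite lt_min d10.
move=> T0 T00; rewrite lt_min => /andP[T01 T02].
set ka := (_ - _ in X in 0 < X) in kap.
pose T (k : nat) := T0 * 2^-1 ^+ k.
have Tpos k : 0 < T k by rewrite mulr_gt0// exprn_gt0// invr_gt0.
have TleT0 k : T k <= T0.
  by rewrite ler_piMr ?(ltW T00)// exprn_ile1 ?invr_ge0// invf_le1// ler1n.
pose be := w2 + eps.
pose cl := c1 * 2^-1 `^ be.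
have cl0 : 0 < cl by rewrite mulr_gt0// powR_gt0// invr_gt0.
pose lam k := cl * T k `^ (be - 1).
have dlow k t : T k / 2 <= t -> t <= T k ->
    lam k <= `|derive1 gamma t| /\ `|derive1 gamma t| <= 1 / 2.
  move=> Tt tT; have Tk := Tpos k; have t0 : 0 < t by lra.
  have tT0 : t <= T0 by exact: le_trans (TleT0 k).
  split; last by apply: ltW; apply: dsmall => //; exact: le_lt_trans T01.
  rewrite -(ler_pM2l Tk).
  apply: le_trans (_ : t * `|derive1 gamma t| <= _); last by rewrite ler_wpM2r.
  apply: le_trans (dcurve_ge c1_gt0 bounds t0).
  have -> : T k * lam k = c1 * (T k / 2) `^ be.
    rewrite /lam /cl [in RHS]powRM ?invr_ge0 ?ltW// mulrCA -{1}(powRr1 (ltW Tk)).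
    rewrite -powRD; last by rewrite (gt_eqF Tk) implybT.
    by rewrite addrC subrK; ring.
  rewrite ler_pM2l//; apply: le_trans (growth t t0 _); last exact: le_lt_trans T02.
  by apply: ge0_ler_powR; rewrite ?nnegrE ?divr_ge0 ?(ltW Tk) ?(ltW t0)// /be; lra.
have lam_pos k : 0 < lam k by rewrite mulr_gt0// powR_gt0.
have T2 k : T k / 2 <= T k by have := Tpos k; lra.
have lam_le k : lam k <= 1 / 2.
  by have [l1 l2] := dlow k (T k) (T2 k) (lexx _); exact: le_trans l2.
apply: (@bounded_on_pieces R curve0 (weight alpha) a b r measurable_curve0
  (measurable_weight alpha) (weight_ge0 alpha) a_gt0 b_gt0 r_gt0 w 0 (Num.min b z - w)
  w_gt0 w_ge (lexx _) _ _ _ _ ab_ge `]0, T0] (fun k => `[T k / 2, T k])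
  T lam (fun=> 1 / 2) T (fun=> 0) (fun k => gamma (T k) - T k / 2)
  (fun k => (T k / 2) `^ (alpha - 1))
  (2^-1 `^ (alpha - 1) * piece_norm a b r w 0 (Num.min b z - w) 1 cl (1 / 2) 1 * T0 `^ ka)
  (2^-1 `^ (ka / 2))).
- by rewrite subr_ge0 le_min w_leb w_lez.
- by rewrite subr_ge0.
- by rewrite lerB// ge_min lexx.
- by rewrite add0r subrK ge_min lexx orbT.
- exact: measurable_itv.
- move=> t /=; rewrite in_itv/= => /andP[t0 tT].
  have [||k [k1 k2]] := @dyadic_bracket R (t / T0).
  + exact: divr_gt0.
  + by rewrite ler_pdivrMr// mul1r.
  exists k => //=; rewrite in_itv/=; apply/andP; split.
  + by rewrite /T -mulrA mulrC -ler_pdivlMr.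
  + by rewrite /T mulrC -ler_pdivrMr.
- by rewrite powR_gt0// invr_gt0.
- have r1 : (1 `^ (ka / 2) = 1 :> R) by rewrite powR1.
  rewrite -[ltRHS]r1; apply: gt0_ltr_powR; rewrite ?nnegrE ?invr_ge0 ?divr_gt0//.
  by rewrite invf_lt1// ltr1n.
- by rewrite /piece_norm !mulr_ge0 ?powR_ge0.
- move=> k; split; [exact: measurable_itv|exact: powR_ge0|].
  move=> t /=; rewrite in_itv/= => /andP[t1 _].
  by apply: weight_le => //; rewrite divr_gt0.
- move=> k; have Tk := Tpos k; have lk := lam_le k; split => //=.
  by rewrite ler_piMl ?(ltW Tk)//; lra.
- move=> k t /=; rewrite in_itv/= => /andP[t1 t2]; have Tk := Tpos k.
  have t0 : 0 < t by lra.
  rewrite curve0E// add0r; split; first by rewrite (ltW t0).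
  pose I := [set u : R | T k / 2 <= u <= T k].
  have : `|gamma t - gamma (T k)| <= 1 / 2 * `|t - T k|.
    apply: (@mvt_lipschitz _ gamma (curve_derivable gamma_C2) I) => //.
    + exact: order_convex_segment.
    + by move=> u /andP[? ?]; lra.
    + by move=> u /andP[u1 u2]; have [] := dlow k u u1 u2.
    + by rewrite /I/= T2 lexx.
    + by rewrite /I/= t1 t2.
  rewrite ler_norml; have -> : `|t - T k| = T k - t by rewrite ler0_norm; lra.
  by move=> /andP[? ?]; apply/andP; split; lra.
- move=> k s t /=; rewrite !in_itv/= => /andP[s1 s2] /andP[t1 t2]; have Tk := Tpos k.
  have s0 : 0 < s by lra. have t0 : 0 < t by lra.
  rewrite !curve0E//.
  pose I := [set u : R | T k / 2 <= u <= T k].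
  have cI : order_convex I.
    exact: order_convex_segment.
  have I0 u : I u -> 0 < u by move=> /andP[? ?]; lra.
  have Is : I s by rewrite /I/= s1 s2.
  have It : I t by rewrite /I/= t1 t2.
  split.
    apply: (@mvt_expand _ gamma (curve_derivable gamma_C2) I) => //.
    by move=> u /andP[u1 u2]; have [] := dlow k u u1 u2.
  have lip : `|gamma t - gamma s| <= 1 / 2 * `|t - s|.
    apply: (@mvt_lipschitz _ gamma (curve_derivable gamma_C2) I) => //.
    by move=> u /andP[u1 u2]; have [] := dlow k u u1 u2.
  have -> : t - gamma t - (s - gamma s) = (t - s) - (gamma t - gamma s) by ring.
  by apply: le_trans (lerB_dist _ _); lra.
move=> k; have Tk := Tpos k.
have -> : piece_norm a b r w 0 (Num.min b z - w) (T k) (lam k) (1 / 2) (T k) =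
  piece_norm a b r w 0 (Num.min b z - w) (1 * T k) (cl * T k `^ (be - 1))
    (1 / 2 * T k `^ 0) (1 * T k `^ 1).
  by rewrite powRr0 powRr1 ?(ltW Tk)// !mul1r mulr1.
rewrite piece_norm_powR// powRM ?invr_ge0 ?(ltW Tk)//.
rewrite -[leRHS]mulrA -scale_powR_geometric ?invr_gt0// -/(T k).
have -> : T k `^ ka = T k `^ (alpha - 1) * T k `^ (1 - a - b + w + 0 + (Num.min b z - w)
  - (be - 1) * (b - w - (Num.min b z - w)) - 0 * w + 1 * (z - 0 - (Num.min b z - w) - w)).
  rewrite -powRD; last by rewrite (gt_eqF Tk) implybT.
  by congr (_ `^ _); rewrite /ka /be; ring.
by rewrite le_eqVlt; apply/orP; left; apply/eqP; ring.
Qed.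

(** On [T, 2 T] with T = T0 2^k both gamma and t - gamma t expand by about
    rho = |gamma T| / T, which is at least T^(w1 - 1 - eps) and grows to infinity, and
    gamma(I) has length about T rho.  The L^1 bound is used for the average of F as
    much as possible; rho then enters with a nonpositive exponent, so that a lower
    bound for rho is enough. *)
Lemma bounded_large (w1 eps : R) : 0 < eps -> eps < w1 - 1 -> omegaoo1 gamma = w1%:E ->
  0 < (a + b - z) - alpha + (w1 - 1 - eps) * (b + Num.min a z - z) ->
  0 <= b + Num.min a z - z ->
  exists2 N : R, 0 < N & (forall t, N <= t -> 2 <= `|derive1 gamma t|) /\
    forall T, N <= T -> bounded `[T, +oo[.
Proof.
move=> eps0 epsw w1E kap v_ge0.
have [N1 N10 growth] := curve_growthoo c1_gt0 bounds eps0 w1E.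
pose be := w1 - 1 - eps.
have be0 : 0 < be by rewrite /be; lra.
(* N2 is chosen such that c1 * N2 ^ be = 2. *)
pose N2 := (2 / c1) `^ be^-1.
have N20 : 0 < N2 by rewrite powR_gt0// divr_gt0.
pose N := Num.max (N1 + 1) (Num.max N2 1).
have [N1N N2N N3N] : [/\ N1 + 1 <= N, N2 <= N & 1 <= N].
  by rewrite /N; split; rewrite !le_max lexx ?orbT.
have ratio t : N <= t -> t `^ be <= `|gamma t| / t.
  move=> Nt; have t0 : 0 < t by lra.
  rewrite ler_pdivlMr// -[X in _ * X](powRr1 (ltW t0)) -powRD; last first.
    by rewrite (gt_eqF t0) implybT.
  have -> : be + 1 = w1 - eps by rewrite /be; ring.
  by apply: growth; lra.
have dcurve2 t : N <= t -> 2 <= `|derive1 gamma t|.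
  move=> Nt; have t0 : 0 < t by lra.
  have := dcurve_ge c1_gt0 bounds t0; rewrite [leRHS]mulrC -ler_pdivrMr//.
  apply: le_trans; rewrite -mulrA; apply: le_trans (_ : c1 * t `^ be <= _); last first.
    by rewrite ler_pM2l//; exact: ratio.
  rewrite mulrC -ler_pdivrMr//; apply: le_trans (_ : N2 `^ be <= _).
    by rewrite /N2 -powRrM mulVf ?gt_eqF// powRr1// divr_ge0 ?ltW.
  by apply: ge0_ler_powR; rewrite ?nnegrE; lra.
exists N; first by lra.
split=> // T0 NT0; have T00 : 0 < T0 by lra.
set ka := (_ + _ in X in 0 < X) in kap.
pose T (k : nat) := T0 * 2 ^+ k.
have Tpos k : 0 < T k by rewrite mulr_gt0// exprn_gt0.
have T0le k : T0 <= T k by rewrite ler_peMr ?(ltW T00)// exprn_ege1// ler1n.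
have NT k : N <= T k by exact: le_trans (T0le k).
pose rho k := `|gamma (T k)| / T k.
have rho_ge k : T k `^ be <= rho k by exact: ratio.
have rho0 k : 0 < rho k by apply: lt_le_trans (rho_ge k); rewrite powR_gt0.
have rho1 k : 1 <= rho k.
  apply: le_trans (rho_ge k).
  have r1 : (1 `^ be = 1 :> R) by rewrite powR1.
  by rewrite -[leLHS]r1; apply: ge0_ler_powR; rewrite ?nnegrE ?(ltW (Tpos k))//; have := NT k; lra.
have gE k : `|gamma (T k)| = T k * rho k by rewrite mulrC /rho divfK// gt_eqF.
have dlow k t : T k <= t -> t <= 2 * T k -> c1 / 2 * rho k <= `|derive1 gamma t|.
  move=> t1 t2; have Tk := Tpos k; have t0 : 0 < t by lra.
  have := dcurve_ge c1_gt0 bounds t0; rewrite [leRHS]mulrC -ler_pdivrMr//.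
  apply: le_trans; rewrite ler_pdivlMr//; apply: le_trans (_ : c1 * (T k * rho k) <= _).
    have -> : c1 / 2 * rho k * t = (c1 * rho k) * (t / 2) by field.
    have -> : c1 * (T k * rho k) = (c1 * rho k) * T k by ring.
    by rewrite (ler_pM2l (mulr_gt0 c1_gt0 (rho0 k))); lra.
  by rewrite -gE ler_pM2l// (curve_norm_mono gamma_C2 gamma_mono gamma_lim0 c1_gt0 bounds).
(* E is large enough for gamma(I) (by doubling) and for the other conditions on L. *)
pose E := 2 * (expR C + c1 + 1).
have C0 := expR_gt0 C.
have c10 := c1_gt0.
have E0 : 0 < E by rewrite /E; lra.
apply: (@bounded_on_pieces R curve0 (weight alpha) a b r measurable_curve0
  (measurable_weight alpha) (weight_ge0 alpha) a_gt0 b_gt0 r_gt0 w (Num.min a z - w) 0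
  w_gt0 w_ge _ (lexx _) _ _ _ ab_ge `[T0, +oo[ (fun k => `[T k, 2 * T k])
  T (fun k => c1 / 2 * rho k) (fun k => c1 / 4 * rho k) (fun k => E * (T k * rho k))
  T (fun k => - (E / 2 * (T k * rho k))) (fun k => T k `^ (alpha - 1))
  (piece_norm a b r w (Num.min a z - w) 0 1 (c1 / 2) (c1 / 4) E * T0 `^ (- ka))
  (2 `^ (- ka / 2))).
- by rewrite subr_ge0 le_min w_lea w_lez.
- by rewrite lerB// ge_min lexx.
- by rewrite subr_ge0.
- by rewrite addr0 subrK ge_min lexx orbT.
- exact: measurable_itv.
- move=> t /=; rewrite in_itv/= andbT => tT; have t0 : 0 < t by exact: lt_le_trans tT.
  have [||k [k1 k2]] := @dyadic_bracket R (T0 / t).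
  + exact: divr_gt0.
  + by rewrite ler_pdivrMr// mul1r.
  have p2 : 0 < 2 ^+ k :> R by rewrite exprn_gt0.
  exists k => //=; rewrite in_itv/= /T; move: k1 k2; rewrite exprVn => k1 k2.
  apply/andP; split.
  + by move: k2; rewrite ler_pdivrMr// mulrC ler_pdivlMr.
  + move: k1; rewrite ler_pdivlMr// mulrAC ler_pdivrMr// mulrC ler_pdivrMr//.
    by rewrite [T0 * 2]mulrC -mulrA.
- by rewrite powR_gt0.
- have r1 : (1 `^ (ka / 2) = 1 :> R) by rewrite powR1.
  rewrite mulNr powRN invf_lt1 ?powR_gt0// -[ltLHS]r1.
  by apply: gt0_ltr_powR; rewrite ?nnegrE ?divr_gt0// ltr1n.
- by rewrite /piece_norm !mulr_ge0 ?powR_ge0.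
- move=> k; split; [exact: measurable_itv|exact: powR_ge0|].
  by move=> t /=; rewrite in_itv/= => /andP[t1 _]; exact: weight_le.
- move=> k; have Tk := Tpos k; have rk := rho0 k; have rk1 := rho1 k.
  have Tr : T k <= T k * rho k by rewrite ler_peMr// ltW.
  have Tr0 : 0 < T k * rho k by rewrite mulr_gt0.
  have l0 : 0 < c1 / 2 * rho k by apply: mulr_gt0 => //; exact: divr_gt0.
  have J0 : 0 < c1 / 4 * rho k by apply: mulr_gt0 => //; exact: divr_gt0.
  split => //=.
  + by apply: le_trans Tr _; rewrite ler_peMl ?(ltW Tr0)// /E; lra.
  + rewrite -mulrA [rho k * _]mulrC ler_pM2r// /E; lra.
- move=> k t /=; rewrite in_itv/= => /andP[t1 t2]; have Tk := Tpos k.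
  have t0 : 0 < t by lra.
  rewrite curve0E//; split; first by rewrite t1/=; lra.
  have : `|gamma t| <= E / 2 * (T k * rho k).
    apply: le_trans (curve_norm_mono gamma_C2 gamma_mono gamma_lim0 c1_gt0 bounds t0 t2) _.
    apply: le_trans (curve_doubling gamma_C2 gamma_mono gamma_lim0 c1_gt0 bounds Tk) _.
    have Tr0 : 0 <= T k * rho k by apply: ltW; exact: mulr_gt0 Tk (rho0 k).
    by rewrite gE; apply: ler_wpM2r; rewrite // /E; lra.
  by rewrite ler_norml => /andP[? ?]; apply/andP; split; lra.
- move=> k s t /=; rewrite !in_itv/= => /andP[s1 s2] /andP[t1 t2]; have Tk := Tpos k.
  have s0 : 0 < s by lra. have t0 : 0 < t by lra.
  rewrite !curve0E//.
  pose I := [set u : R | T k <= u <= 2 * T k].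
  have cI : order_convex I.
    exact: order_convex_segment.
  have I0 u : I u -> 0 < u by move=> /andP[? ?]; lra.
  have Is : I s by rewrite /I/= s1 s2.
  have It : I t by rewrite /I/= t1 t2.
  split.
    apply: (@mvt_expand _ gamma (curve_derivable gamma_C2) I) => //.
    by move=> u /andP[u1 u2]; exact: dlow.
  apply: (@mvt_expand _ (fun u => u - gamma u) _ I) => //.
    by move=> u u0; apply: derivableB => //; exact: curve_derivable.
  move=> u /andP[u1 u2]; have u0 : 0 < u by exact: I0 (introT andP (conj u1 u2)).
  rewrite derive1_idB//.
  have d2 : 2 <= `|derive1 gamma u| by apply: dcurve2; exact: le_trans u1.
  have dl := dlow k u u1 u2.
  apply: le_trans (_ : `|derive1 gamma u| - `|1 : R| <= _).
    by rewrite normr1; lra.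
  by rewrite distrC lerB_dist.
move=> k; have Tk := Tpos k; have rk := rho0 k.
rewrite -[X in piece_norm _ _ _ _ _ _ X](mul1r (T k)) piece_norm_powR2//; last 2 first.
- exact: divr_gt0.
- exact: divr_gt0.
rewrite -[leRHS]mulrA -scale_powR_geometric// -/(T k).
set P := piece_norm _ _ _ _ _ _ _ _ _ _.
have P0 : 0 <= P by rewrite /P /piece_norm !mulr_ge0 ?powR_ge0.
rewrite mulrCA ler_wpM2l// mulrA -powRD; last by rewrite (gt_eqF Tk) implybT.
set v := b + Num.min a z - z in ka kap v_ge0 *.
have -> : - (b - w - 0) - w + (z - (Num.min a z - w) - 0 - w) = - v by rewrite /v; ring.
have -> : T k `^ (- ka) = T k `^ (alpha - (a + b - z)) * T k `^ (be * - v).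
  rewrite -powRD; last by rewrite (gt_eqF Tk) implybT.
  by congr (_ `^ _); rewrite /ka /be; ring.
rewrite powRrM !powRN; apply: ler_pM; rewrite ?powR_ge0 ?invr_ge0 ?powR_ge0//.
  by rewrite le_eqVlt; apply/orP; left; apply/eqP; congr (_ `^ _); ring.
rewrite lef_pV2 ?posrE ?powR_gt0//.
by apply: ge0_ler_powR; rewrite ?nnegrE ?powR_ge0 ?(ltW rk).
Qed.

(** On a compact range of t only the point t0, where t - gamma t may have derivative 0,
    is delicate.  At distance about h from it, t - gamma t expands by about h while I
    and gamma(I) have length about h, and the norm of the piece is of order
    h^(1 - (a + b - 1/r) - w).  The two sides sg of t0 are treated separately, as
    t - gamma t need not be injective across t0. *)
Lemma bounded_middle (sg del t0 N k0 : R) : sg = 1 \/ sg = -1 ->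
  0 < del -> del <= t0 -> t0 <= N -> 0 < k0 ->
  (forall t, del <= t -> t <= N -> k0 * `|t - t0| <= `|1 - derive1 gamma t|) ->
  0 < 1 - (a + b - z) - w ->
  measurable [set t | del <= t <= N /\ 0 < sg * (t - t0)] /\
  bounded [set t | del <= t <= N /\ 0 < sg * (t - t0)].
Proof.
move=> sgE del0 delt0 t0N k00 cross kap.
have t00 : 0 < t0 by lra.
have N0 : 0 < N by lra.
have sgn x : `|sg * x| = `|x|.
  by rewrite normrM; case: sgE => ->; rewrite ?normrN normr1 mul1r.
pose m := c1 * `|gamma del| / N.
pose K := C * `|gamma N| / del.
have m0 : 0 < m by rewrite divr_gt0// mulr_gt0// (curve_norm_gt0 c1_gt0 bounds).
have K0 : 0 < K by rewrite divr_gt0// mulr_gt0// (curve_norm_gt0 c1_gt0 bounds).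
have gmono := curve_norm_mono gamma_C2 gamma_mono gamma_lim0 c1_gt0 bounds.
have m_le t : del <= t -> t <= N -> m <= `|derive1 gamma t|.
  move=> dt tN; have t_gt0 : 0 < t by lra.
  rewrite ler_pdivrMr//; apply: le_trans (_ : c1 * `|gamma t| <= _).
    by rewrite ler_pM2l//; exact: gmono.
  apply: le_trans (dcurve_ge c1_gt0 bounds t_gt0) _.
  by rewrite mulrC ler_wpM2l.
have K_ge t : del <= t -> t <= N -> `|derive1 gamma t| <= K.
  move=> dt tN; have t_gt0 : 0 < t by lra.
  rewrite ler_pdivlMr//; apply: le_trans (_ : C * `|gamma t| <= _); last first.
    by rewrite ler_pM2l//; exact: gmono.
  apply: le_trans (dcurve_le c1_gt0 bounds t_gt0).
  by rewrite mulrC ler_wpM2r.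
have msg : measurable_fun [set: R] (fun t => sg * (t - t0)).
  by apply: measurable_funM => //; exact: measurable_funB.
have mset (S : set R) : measurable S ->
    measurable [set t | del <= t <= N /\ S (sg * (t - t0))].
  move=> mS.
  rewrite (_ : [set t | _] = `[del, N] `&` (fun t => sg * (t - t0)) @^-1` S).
    apply: measurableI; first exact: measurable_itv.
    by rewrite -[X in measurable X]setTI; apply: msg.
  by apply/seteqP; split => t /=; rewrite in_itv.
set D := [set t | _].
have mD : measurable D.
  rewrite (_ : D = [set t | del <= t <= N /\ [set` `]0, +oo[%R] (sg * (t - t0))]).
    by apply: mset; exact: measurable_itv.
  by apply/seteqP; split => t /=; rewrite in_itv/= andbT.
split=> //.
set ka := 1 - _ - w in kap.
pose h (k : nat) := N * 2^-1 ^+ k.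
have hpos k : 0 < h k by rewrite mulr_gt0// exprn_gt0// invr_gt0.
pose I k := [set t | del <= t <= N /\ h k / 2 <= sg * (t - t0) <= h k].
have IE k t : I k t -> [/\ del <= t, t <= N, h k / 2 <= sg * (t - t0) & sg * (t - t0) <= h k].
  by move=> [/andP[? ?] /andP[? ?]].
have Idist k t : I k t -> h k / 2 <= `|t - t0| /\ `|t - t0| <= h k.
  move=> /IE[_ _ i1 i2]; have hk := hpos k.
  have := sgn (t - t0); rewrite ger0_norm; last by lra.
  by move=> <-.
have cI k : order_convex (I k).
  move=> u v xi /IE[u1 u2 u3 u4] /IE[v1 v2 v3 v4] uxi xiv; split.
    by apply/andP; split; lra.
  case: sgE => sgE; rewrite sgE in u3 u4 v3 v4 *; apply/andP; split; lra.
have I0 k t : I k t -> 0 < t by move=> /IE[? _ _ _]; lra.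
pose E := K + 1 + m.
have E0 : 0 < E by rewrite /E; lra.
apply: (@bounded_on_pieces R curve0 (weight alpha) a b r measurable_curve0
  (measurable_weight alpha) (weight_ge0 alpha) a_gt0 b_gt0 r_gt0 w 0 0
  w_gt0 w_ge (lexx _) (lexx _) _ _ _ ab_ge D I
  (fun k => 2 * h k) (fun=> m) (fun k => k0 / 2 * h k) (fun k => 2 * E * h k)
  (fun k => t0 - h k) (fun k => gamma t0 - E * h k)
  (fun=> del `^ (alpha - 1))
  (del `^ (alpha - 1) * piece_norm a b r w 0 0 2 m (k0 / 2) (2 * E) * N `^ ka)
  (2^-1 `^ (ka / 2))) => //.
- by rewrite subr_ge0.
- by rewrite subr_ge0.
- by rewrite !add0r.
- move=> t [/andP[t1 t2] tpos]; have t_gt0 : 0 < t by lra.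
  have [||k [k1 k2]] := @dyadic_bracket R (sg * (t - t0) / N).
  + exact: divr_gt0.
  + rewrite ler_pdivrMr// mul1r; apply: le_trans (ler_norm _) _.
    by rewrite sgn ler_norml; apply/andP; split; lra.
  exists k => //; split; first by rewrite t1.
  apply/andP; split.
  + by rewrite /h -mulrA mulrC -ler_pdivlMr.
  + by rewrite /h [leRHS]mulrC -ler_pdivrMr.
- have r1 : (1 `^ (ka / 2) = 1 :> R) by rewrite powR1.
  rewrite -[ltRHS]r1; apply: gt0_ltr_powR; rewrite ?nnegrE ?invr_ge0 ?divr_gt0//.
  by rewrite invf_lt1// ltr1n.
- by rewrite /piece_norm !mulr_ge0 ?powR_ge0.
- move=> k; split; [|exact: powR_ge0|].
    rewrite (_ : I k = [set t | del <= t <= N /\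
        [set` `[h k / 2, h k]%R] (sg * (t - t0))]).
      by apply: mset; exact: measurable_itv.
    by apply/seteqP; split => t /=; rewrite in_itv.
  by move=> t /IE[t1 _ _ _]; exact: weight_le.
- move=> k; have hk := hpos k; have d0 : 0 < k0 / 2 * h k by rewrite mulr_gt0 ?divr_gt0.
  have h2 : 0 < 2 * h k by lra.
  have -> : 2 * E * h k = E * (2 * h k) by ring.
  split => //.
  + by rewrite ler_peMl ?(ltW h2)// /E; lra.
  + by rewrite ler_pM2r// /E; lra.
- move=> k t It; have [i1 i2] := Idist k t It; have [t1 t2 _ _] := IE _ _ It.
  have hk := hpos k.
  rewrite curve0E ?(I0 k)//; split.
    by move: i2; rewrite ler_norml => /andP[? ?]; apply/andP; split; lra.
  pose I' := [set u : R | del <= u <= N].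
  have : `|gamma t - gamma t0| <= K * `|t - t0|.
    apply: (@mvt_lipschitz _ gamma (curve_derivable gamma_C2) I').
    + exact: order_convex_segment.
    + by move=> u /andP[? ?]; lra.
    + by move=> u /andP[? ?]; exact: K_ge.
    + by rewrite /I'/= delt0.
    + by rewrite /I'/= t1.
  have Kh : K * `|t - t0| <= E * h k by apply: ler_pM => //; rewrite ?(ltW K0)// /E; lra.
  by move=> /le_trans/(_ Kh); rewrite ler_norml => /andP[? ?]; apply/andP; split; lra.
- move=> k s t Is It; have s0 := I0 _ _ Is; have t_gt0 := I0 _ _ It.
  rewrite !curve0E//; split.
    apply: (@mvt_expand _ gamma (curve_derivable gamma_C2) (I k)) => //; first exact: I0.
    by move=> u /IE[u1 u2 _ _]; exact: m_le.
  apply: (@mvt_expand _ (fun u => u - gamma u) _ (I k)) => //.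
  + by move=> u u0; apply: derivableB => //; exact: curve_derivable.
  + exact: I0.
  move=> u Iu; have u0 := I0 _ _ Iu; have [u1 u2 _ _] := IE _ _ Iu.
  rewrite derive1_idB//.
  apply: le_trans (cross u u1 u2); rewrite -mulrA ler_pM2l// mulrC.
  by have [] := Idist _ _ Iu.
move=> k; have hk := hpos k.
have -> : piece_norm a b r w 0 0 (2 * h k) m (k0 / 2 * h k) (2 * E * h k) =
  piece_norm a b r w 0 0 (2 * h k) (m * h k `^ 0) (k0 / 2 * h k `^ 1) (2 * E * h k `^ 1).
  by rewrite powRr0 powRr1 ?(ltW hk)// mulr1.
rewrite piece_norm_powR//; last 2 first.
- exact: divr_gt0.
- by rewrite mulr_gt0.
rewrite -[leRHS]mulrA -scale_powR_geometric ?invr_gt0// -/(h k).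
rewrite le_eqVlt; apply/orP; left; apply/eqP; rewrite mulrA; congr (_ * _ `^ _).
by rewrite /ka; ring.
Qed.

End Regimes.

(** * From nonnegative to complex functions *)

(** The integral of a nonnegative function is a supremum over the simple functions
    below it; so the lemma applies to the modulus of the operator, a function about
    which nothing but an upper bound is known. *)
Lemma ge0_integral_mono d (T : measurableType d) (R : realType)
    (mu : {measure set T -> \bar R}) (f g : T -> \bar R) :
  (forall x, 0 <= f x)%E -> (forall x, f x <= g x)%E ->
  (\int[mu]_x f x <= \int[mu]_x g x)%E.
Proof.
move=> f0 fg; have g0 x : (0 <= g x)%E by exact: le_trans (fg x).
rewrite !ge0_integralTE//; apply: le_ereal_sup => _ [h hf <-]; exists h => //.
by move=> x; exact: le_trans (hf x) (fg x).
Qed.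

Section ComplexModulus.
Context {R : realType}.
Local Notation normc := (@ComplexField.Normc.normc R).

Lemma Re_le_normc (x : R[i]) : `|complex.Re x| <= normc x.
Proof.
case: x => u v; rewrite /= -sqrtr_sqr ler_wsqrtr//.
by rewrite lerDl sqr_ge0.
Qed.

Lemma Im_le_normc (x : R[i]) : `|complex.Im x| <= normc x.
Proof.
case: x => u v; rewrite /= -sqrtr_sqr ler_wsqrtr//.
by rewrite lerDr sqr_ge0.
Qed.

Lemma normc_ge0 (x : R[i]) : 0 <= normc x.
Proof. by case: x => u v; exact: sqrtr_ge0. Qed.

Lemma normc_le_add (u v : R) : normc (Complex u v) <= `|u| + `|v|.
Proof.
rewrite /= -[leRHS]ger0_norm ?addr_ge0// -sqrtr_sqr ler_wsqrtr//.
rewrite sqrrD -[in leLHS](real_normK (num_real u)) -[in leLHS](real_normK (num_real v)).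
by rewrite addrAC lerDl mulrn_wge0// mulr_ge0.
Qed.

Lemma normc_real (u : R) : 0 <= u -> normc (real_complex R u) = u.
Proof. by move=> u0; rewrite /= expr0n/= addr0 sqrtr_sqr ger0_norm. Qed.

Lemma measurable_cmodulus (D : set R) (f : R -> R[i]) :
  cmeasurable D f -> measurable_fun D (cmodulus f).
Proof.
move=> [mRe mIm].
rewrite (_ : cmodulus f = fun x =>
    Num.sqrt (complex.Re (f x) ^+ 2 + complex.Im (f x) ^+ 2)); last first.
  by apply/funext => x; rewrite /cmodulus; case: (f x).
apply: (@measurableT_comp _ _ _ _ _ _ (@Num.sqrt R)).
  by apply: continuous_measurable_fun; exact: sqrt_continuous.
by apply: measurable_funD; exact: measurable_funX.
Qed.

End ComplexModulus.

Section Transfer.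
Context {R : realType} (gamma : R -> R) (alpha p q r : R).
Local Notation mu := (@lebesgue_measure R).
Local Open Scope ereal_scope.
Hypothesis mgamma : measurable_fun [set: R] (curve0 gamma).
Hypotheses (p_gt0 : (0 < p)%R) (q_gt0 : (0 < q)%R) (r_gt0 : (0 < r)%R).

Let D : set R := [set` `]0%R, +oo[%R].
Let Dpos t : D t -> (0 < t)%R.
Proof. by rewrite /D/= in_itv/= andbT. Qed.
Let mD : measurable D. Proof. exact: measurable_itv. Qed.

Definition abs_form (f g : R -> R[i]) (x : R) : \bar R :=
  \int[mu]_(t in D) (cmodulus f (x - t) * cmodulus g (x - curve0 gamma t) * weight alpha t)%:E.

Lemma cLnorm_le_integral (s P : R) (f : R -> R[i]) : (0 < s)%R -> (0 < P)%R ->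
  cLnorm s f <= P%:E -> \int[mu]_x (cmodulus f x `^ s)%:E <= (P `^ s)%:E.
Proof.
move=> s0 P0; rewrite /cLnorm unlock => fP.
have E : \int[mu]_x (cmodulus f x `^ s)%:E =
    \int[mu]_x `|(EFin \o cmodulus f) x| `^ s.
  by apply: eq_integral => x _; rewrite /= ger0_norm ?normc_ge0.
have I0 : 0 <= \int[mu]_x `|(EFin \o cmodulus f) x| `^ s.
  by apply: integral_ge0 => x _; exact: poweR_ge0.
rewrite E -[leLHS](poweRe1 I0) -(mulVf (lt0r_neq0 s0)) poweRrM -poweR_EFin.
by apply: le_poweR => //; [exact: ltW|exact: poweR_ge0].
Qed.

Let scaled (s P : R) (f : R -> R[i]) (x : R) : R := (cmodulus f x / P) `^ s.

Lemma scaled_mass (s P : R) (f : R -> R[i]) : (0 < s)%R -> (0 < P)%R ->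
  in_Lp s f -> cLnorm s f <= P%:E -> mass_le1 (scaled s P f).
Proof.
move=> s0 P0 [mf _] fP; split.
- apply: (measurableT_comp (measurable_powR s)).
  by apply: measurable_funM => //; exact: measurable_cmodulus.
- by move=> x; exact: powR_ge0.
rewrite /scaled; under eq_integral.
  move=> x _; rewrite powRM ?normc_ge0 ?invr_ge0 ?(ltW P0)// mulrC EFinM. over.
rewrite ge0_integralZl//.
- apply: le_trans (lee_wpmul2l _ (cLnorm_le_integral s0 P0 fP)) _.
    by rewrite lee_fin powR_ge0.
  by rewrite -EFinM -powRM ?invr_ge0 ?(ltW P0)// mulVf ?gt_eqF// powR1.
- apply/measurable_EFinP; apply: (measurableT_comp (measurable_powR s)).
  exact: measurable_cmodulus.
- by move=> x _; rewrite lee_fin powR_ge0.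
- by rewrite lee_fin powR_ge0.
Qed.

Lemma abs_form_scaled (P Q : R) (f g : R -> R[i]) x : (0 < P)%R -> (0 < Q)%R ->
  in_Lp p f -> cLnorm p f <= P%:E -> in_Lp q g -> cLnorm q g <= Q%:E ->
  abs_form f g x = (P * Q)%:E *
    weighted_avg (curve0 gamma) (weight alpha) p^-1 q^-1 D (scaled p P f) (scaled q Q g) x.
Proof.
move=> P0 Q0 fp fP gq gQ.
have PQ0 : (0 < P * Q)%R by exact: mulr_gt0.
have F1 := scaled_mass p_gt0 P0 fp fP; have G1 := scaled_mass q_gt0 Q0 gq gQ.
rewrite /weighted_avg -ge0_integralZl//.
- apply: eq_integral => t _; rewrite -EFinM; congr EFin.
  rewrite /scaled -!powRrM !mulfV ?gt_eqF// !powRr1 ?divr_ge0 ?normc_ge0 ?(ltW P0) ?(ltW Q0)//.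
  by field; rewrite !gt_eqF.
- apply: measurable_funTS.
  exact: (measurable_weighted_section _ _ mgamma (measurable_weight alpha) x F1 G1).
- by move=> t _; rewrite lee_fin !mulr_ge0 ?powR_ge0 ?weight_ge0.
- by rewrite lee_fin ltW.
Qed.

Let integrand_norm f g x t :
  (`|complex.Re (Hintegrand alpha gamma f g x t)| <=
    cmodulus f (x - t) * cmodulus g (x - gamma t) * weight alpha t)%R /\
  (`|complex.Im (Hintegrand alpha gamma f g x t)| <=
    cmodulus f (x - t) * cmodulus g (x - gamma t) * weight alpha t)%R.
Proof.
have E : ComplexField.Normc.normc (Hintegrand alpha gamma f g x t) =
    (cmodulus f (x - t) * cmodulus g (x - gamma t) * weight alpha t)%R.
  rewrite /Hintegrand !ComplexField.Normc.normcM normc_real//.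
  by rewrite invr_ge0 powR_ge0.
by rewrite -E; split; [exact: Re_le_normc|exact: Im_le_normc].
Qed.

Let integrand_measurable f g x : cmeasurable setT f -> cmeasurable setT g ->
  cmeasurable D (Hintegrand alpha gamma f g x).
Proof.
move=> [mRf mIf] [mRg mIg].
have ms (u : R -> R) : measurable_fun [set: R] u -> measurable_fun D (fun t => u (x - t)%R).
  by move=> mu_; apply: measurable_funTS; exact: (measurableT_comp mu_ (measurable_shift x)).
have mg (u : R -> R) : measurable_fun [set: R] u ->
    measurable_fun D (fun t => u (x - gamma t)%R).
  move=> mu_; apply: (@eq_measurable_fun _ _ _ _ _ (fun t => u (x - curve0 gamma t)%R)).
    by move=> t; rewrite inE => /Dpos t0; rewrite curve0E.
  apply: measurable_funTS.
  exact: (measurableT_comp mu_ (measurable_shift_curve mgamma x)).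
have mw : measurable_fun D (weight alpha) by apply: measurable_funTS; exact: measurable_weight.
split.
  rewrite (_ : (fun t => _) = (fun t => (complex.Re (f (x - t)) * complex.Re (g (x - gamma t)) -
     complex.Im (f (x - t)) * complex.Im (g (x - gamma t))) * weight alpha t)%R); last first.
    apply/funext => t; rewrite /Hintegrand /weight.
    by case: (f _) => ? ?; case: (g _) => ? ? /=; ring.
  apply: measurable_funM => //; apply: measurable_funB; apply: measurable_funM.
  - exact: (ms _ mRf).
  - exact: (mg _ mRg).
  - exact: (ms _ mIf).
  - exact: (mg _ mIg).
rewrite (_ : (fun t => _) = (fun t => (complex.Re (f (x - t)) * complex.Im (g (x - gamma t)) +
   complex.Im (f (x - t)) * complex.Re (g (x - gamma t))) * weight alpha t)%R); last first.
  apply/funext => t; rewrite /Hintegrand /weight.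
  by case: (f _) => ? ?; case: (g _) => ? ? /=; ring.
apply: measurable_funM => //; apply: measurable_funD; apply: measurable_funM.
- exact: (ms _ mRf).
- exact: (mg _ mIg).
- exact: (ms _ mIf).
- exact: (mg _ mRg).
Qed.

Let abs_integrals_le f g x : cmeasurable setT f -> cmeasurable setT g ->
  \int[mu]_(t in D) `|(complex.Re (Hintegrand alpha gamma f g x t))%:E| <= abs_form f g x /\
  \int[mu]_(t in D) `|(complex.Im (Hintegrand alpha gamma f g x t))%:E| <= abs_form f g x.
Proof.
move=> mf mg; have [mRe mIm] := integrand_measurable x mf mg.
have mabs : measurable_fun D (fun t =>
    (cmodulus f (x - t) * cmodulus g (x - curve0 gamma t) * weight alpha t)%:E).
  apply/measurable_EFinP; apply: measurable_funTS; apply: measurable_funM; last first.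
    exact: measurable_weight.
  apply: measurable_funM.
    exact: (measurableT_comp (measurable_cmodulus mf) (measurable_shift x)).
  exact: (measurableT_comp (measurable_cmodulus mg) (measurable_shift_curve mgamma x)).
split; apply: ge0_le_integral => //.
- by apply: measurableT_comp => //; exact/measurable_EFinP.
- by move=> t /Dpos t0; rewrite abse_EFin lee_fin curve0E//; have [] := integrand_norm f g x t.
- by apply: measurableT_comp => //; exact/measurable_EFinP.
- by move=> t /Dpos t0; rewrite abse_EFin lee_fin curve0E//; have [] := integrand_norm f g x t.
Qed.

(** For norms bounded by positive P and Q, the functions (|f|/P)^p and (|g|/Q)^q have
    mass at most 1, which turns the boundedness on the half-line into a bound for the
    integral of absolute values; being finite almost everywhere, that integral gives
    the absolute convergence as well.  P and Q are then sent to the norms. *)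
Theorem operator_bound :
  bounded_on (curve0 gamma) (weight alpha) p^-1 q^-1 r D ->
  exists K : R, (0 < K)%R /\
    forall f g : R -> R[i], in_Lp p f -> in_Lp q g ->
      {ae mu, forall x, cintegrable D (Hintegrand alpha gamma f g x)} /\
      cLnorm r (Hop alpha gamma f g) <= K%:E * cLnorm p f * cLnorm q g.
Proof.
move=> [C C0 bC].
pose K := (2 * C `^ r^-1 + 1)%R.
have K0 : (0 < K)%R by rewrite ltr_wpDl// mulr_ge0// powR_ge0.
exists K; split=> // f g fp gq.
have [mf fpoo] := fp; have [mg gqoo] := gq.
have Nf0 : 0 <= cLnorm p f by exact: Lnorm_ge0.
have Ng0 : 0 <= cLnorm q g by exact: Lnorm_ge0.
have ffin : cLnorm p f \is a fin_num by rewrite ge0_fin_numE.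
have gfin : cLnorm q g \is a fin_num by rewrite ge0_fin_numE.
pose nf := fine (cLnorm p f); pose ng := fine (cLnorm q g).
have nf0 : (0 <= nf)%R by exact: fine_ge0.
have ng0 : (0 <= ng)%R by exact: fine_ge0.
have fE : cLnorm p f = nf%:E by rewrite /nf fineK.
have gE : cLnorm q g = ng%:E by rewrite /ng fineK.
have abs0 x : 0 <= abs_form f g x.
  by apply: integral_ge0 => t _; rewrite lee_fin !mulr_ge0 ?normc_ge0 ?weight_ge0.
have bound (P Q : R) : (0 < P)%R -> (0 < Q)%R -> cLnorm p f <= P%:E -> cLnorm q g <= Q%:E ->
    measurable_fun [set: R] (abs_form f g) /\
    \int[mu]_x (abs_form f g x `^ r) <= ((P * Q) `^ r * C)%:E.
  move=> P0 Q0 fP gQ.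
  have F1 := scaled_mass p_gt0 P0 fp fP; have G1 := scaled_mass q_gt0 Q0 gq gQ.
  have PQ0 : (0 <= P * Q)%R by rewrite mulr_ge0 ?ltW.
  pose W x := weighted_avg (curve0 gamma) (weight alpha) p^-1 q^-1 D
     (scaled p P f) (scaled q Q g) x.
  have mW : measurable_fun [set: R] W.
    exact: (measurable_weighted_avg _ _ mgamma (measurable_weight alpha)
      (weight_ge0 alpha) mD F1 G1).
  have W0 x : 0 <= W x by apply: weighted_avg_ge0; exact: weight_ge0.
  have -> : abs_form f g = fun x => (P * Q)%:E * W x.
    by apply/funext => x; exact: abs_form_scaled.
  split; first exact: measurable_funeM.
  under eq_integral do rewrite poweRM ?lee_fin// poweR_EFin.
  rewrite ge0_integralZl//.
  - by rewrite EFinM lee_wpmul2l ?lee_fin ?powR_ge0//; exact: bC.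
  - exact: (measurableT_comp (measurable_poweR r)).
  - by move=> x _; exact: poweR_ge0.
  - by rewrite lee_fin powR_ge0.
have fP1 : cLnorm p f <= (nf + 1)%:E by rewrite fE lee_fin lerDl.
have gQ1 : cLnorm q g <= (ng + 1)%:E by rewrite gE lee_fin lerDl.
have nf1 : (0 < nf + 1)%R by rewrite ltr_wpDl.
have ng1 : (0 < ng + 1)%R by rewrite ltr_wpDl.
have [mabs bound1] := bound _ _ nf1 ng1 fP1 gQ1.
have mabsr : measurable_fun [set: R] (fun x => abs_form f g x `^ r).
  exact: (measurableT_comp (measurable_poweR r)).
split.
  have intr : mu.-integrable setT (fun x => abs_form f g x `^ r).
    apply/integrableP; split => //.
    under eq_integral do rewrite gee0_abs ?poweR_ge0//.
    by apply: le_lt_trans bound1 _; rewrite ltry.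
  have [mRe mIm] := (mf, mg).
  apply: filterS (integrable_ae measurableT intr) => x /(_ I) xfin.
  have xlt : abs_form f g x < +oo.
    rewrite ltey; apply/eqP => xoo; move: xfin.
    by rewrite xoo poweRyr ?gt_eqF.
  have [iRe iIm] := abs_integrals_le x mf mg.
  have [mRe' mIm'] := integrand_measurable x mf mg.
  split; apply/integrableP; split.
  - exact/measurable_EFinP.
  - exact: le_lt_trans iRe xlt.
  - exact/measurable_EFinP.
  - exact: le_lt_trans iIm xlt.
have Hop_le x : (cmodulus (Hop alpha gamma f g) x)%:E <= 2%:E * abs_form f g x.
  have [iRe iIm] := abs_integrals_le x mf mg.
  have [mRe' mIm'] := integrand_measurable x mf mg.
  have fine_le (h : R -> R) : measurable_fun D h ->
      (`|fine (\int[mu]_(t in D) (h t)%:E)|)%:E <= \int[mu]_(t in D) `|(h t)%:E|.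
    move=> mh; apply: le_trans (_ : `|\int[mu]_(t in D) (h t)%:E| <= _).
      by case: (\int[mu]_(t in D) _) => //=; rewrite normr0 leey.
    by apply: le_abse_integral => //; exact/measurable_EFinP.
  rewrite mule_natl mule2n.
  pose h t := Hintegrand alpha gamma f g x t.
  apply: le_trans (_ : (`|fine (\int[mu]_(t in D) (complex.Re (h t))%:E)| +
     `|fine (\int[mu]_(t in D) (complex.Im (h t))%:E)|)%:E <= _).
    by rewrite lee_fin; exact: normc_le_add.
  rewrite EFinD; apply: leeD.
    exact: le_trans (fine_le _ mRe') iRe.
  exact: le_trans (fine_le _ mIm') iIm.
have norm_bound (P Q : R) : (0 < P)%R -> (0 < Q)%R -> cLnorm p f <= P%:E ->
    cLnorm q g <= Q%:E -> cLnorm r (Hop alpha gamma f g) <= (K * (P * Q))%:E.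
  move=> P0 Q0 fP gQ; have [_ bPQ] := bound P Q P0 Q0 fP gQ.
  have PQ0 : (0 <= P * Q)%R by rewrite mulr_ge0 ?ltW.
  have r0 : (0 <= r)%R by exact: ltW.
  rewrite /cLnorm unlock.
  have I1 : \int[mu]_x `|(EFin \o cmodulus (Hop alpha gamma f g)) x| `^ r <=
      ((2 * (P * Q)) `^ r * C)%:E.
    apply: le_trans (_ : \int[mu]_x ((2 `^ r)%:E * abs_form f g x `^ r) <= _).
      apply: ge0_integral_mono => x; first exact: poweR_ge0.
      rewrite -poweR_EFin -poweRM ?lee_fin//; apply: le_poweR => //.
      by rewrite /= ger0_norm ?normc_ge0//; exact: Hop_le.
    rewrite ge0_integralZl//.
    - rewrite powRM// -mulrA EFinM lee_wpmul2l ?lee_fin ?powR_ge0//.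
    - by move=> x _; exact: poweR_ge0.
  apply: le_trans (le_poweR _ _ I1) _; rewrite ?invr_ge0//.
    by apply: integral_ge0 => x _; exact: poweR_ge0.
  have PQ2 : (0 <= 2 * (P * Q))%R by exact: mulr_ge0.
  rewrite poweR_EFin lee_fin powRM ?powR_ge0// -powRrM mulfV ?gt_eqF// powRr1//.
  rewrite mulrAC ler_wpM2r// /K; lra.
rewrite fE gE -!EFinM; apply/lee_addgt0Pr => eps eps0.
have S0 : (0 < K * (nf + ng + 1))%R by rewrite mulr_gt0//; lra.
pose e := Num.min 1%R (eps / (K * (nf + ng + 1)))%R.
have e0 : (0 < e)%R by rewrite lt_min ltr01 divr_gt0.
have e1 : (e <= 1)%R by rewrite ge_min lexx.
have eS : (e * (K * (nf + ng + 1)) <= eps)%R.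
  by rewrite -ler_pdivlMr// ge_min lexx orbT.
apply: le_trans (norm_bound (nf + e)%R (ng + e)%R _ _ _ _) _.
- by rewrite ltr_wpDl.
- by rewrite ltr_wpDl.
- by rewrite fE lee_fin lerDl ltW.
- by rewrite gE lee_fin lerDl ltW.
rewrite -EFinD lee_fin; apply: le_trans (_ : K * nf * ng + e * (K * (nf + ng + 1)) <= _)%R.
  have -> : (K * nf * ng + e * (K * (nf + ng + 1)) = K * (nf * ng + e * (nf + ng + 1)))%R.
    by ring.
  rewrite ler_pM2l//; nra.
by rewrite lerD2l.
Qed.

End Transfer.

Unset Implicit Arguments.

(** * The theorem *)

Theorem theorem1p2 (R : realType) (alpha : R) (gamma : R -> R)
  (alpha_gt0 : 0 < alpha) (alpha_lt1 : alpha < 1)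
  (gamma_C2 : C2_pos gamma)
  (gamma_mono : monotonic_pos gamma)
  (gamma_lim0 : gamma t @[t --> 0^'+] --> (0 : R))
  (dgamma_lim0 : gamma^`() t @[t --> 0^'+] --> (0 : R))
  (omega_le : (omega02 gamma <= omegaoo1 gamma)%E)
  (omega01_gt1 : (1 < omega01 gamma)%E)
  (gamma_bounds : exists C11 C12 C21 : R,
     [/\ 0 < C11, 0 < C12, 0 < C21 &
      forall t : R, 0 < t ->
        [/\ `|t * derive1 gamma t / gamma t| <= C21,
            C11 <= `|t * derive1 gamma t / gamma t|
          & C12 <= `|t ^+ 2 * derive1n 2 gamma t / gamma t|]])
  (alpha_omega : (omegaoo1 gamma <= (alpha / (1 - alpha))%:E)%E)
  (p q r : R) (p_gt0 : 0 < p) (q_gt0 : 0 < q) (r_gt0 : 0 < r)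
  (pqr : open_convex_hull
           (vertices alpha (fine (omegaoo1 gamma)) (fine (omega02 gamma)))
           (p^-1, q^-1, r^-1)) :
  exists C : R, 0 < C /\
    forall f g : R -> R[i], in_Lp p f -> in_Lp q g ->
      {ae (@lebesgue_measure R), forall x,
         cintegrable `]0, +oo[ (Hintegrand alpha gamma f g x)} /\
      (cLnorm r (Hop alpha gamma f g) <= C%:E * cLnorm p f * cLnorm q g)%E.
Proof.
have [c1 [c2 [C [c10 c20 C0 bounds]]]] := gamma_bounds.
have omega02_gt1 : (1 < omega02 gamma)%E.
  by apply: lt_le_trans omega01_gt1 _; exact: limf_einf_le_esup.
have omegaoo_gt1 := lt_le_trans omega02_gt1 omega_le.
have oo_fin : omegaoo1 gamma \is a fin_num.
  rewrite fin_numE gt_eqF ?(lt_trans _ omegaoo_gt1) ?ltNyr// lt_eqF//.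
  by rewrite (le_lt_trans alpha_omega) ?ltry.
have o2_fin : omega02 gamma \is a fin_num.
  rewrite fin_numE gt_eqF ?(lt_trans _ omega02_gt1) ?ltNyr// lt_eqF//.
  by rewrite (le_lt_trans omega_le)// (le_lt_trans alpha_omega) ?ltry.
have omegaA : omegaoo1 gamma = (fine (omegaoo1 gamma))%:E by rewrite fineK.
have omegaB : omega02 gamma = (fine (omega02 gamma))%:E by rewrite fineK.
move: pqr; set A := fine _ in omegaA *; set B := fine _ in omegaB * => hull.
have B1 : 1 < B by rewrite -lte_fin -omegaB.
have BA : B <= A by rewrite -lee_fin -omegaB -omegaA.
have Aal : A <= alpha / (1 - alpha) by rewrite -lee_fin -omegaA.
have A1 : 1 < A by lra.
have a0 : 0 < p^-1 by rewrite invr_gt0.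
have b0 : 0 < q^-1 by rewrite invr_gt0.
have z0 : 0 < r^-1 by rewrite invr_gt0.
have ineq := hull_inequalities alpha_gt0 alpha_lt1 B1 BA Aal hull.
have [w [eps [[w0 w_ge wa wb wz] [eps0 epsA mid large small]]]] :=
  exponents_choice a0 b0 z0 A1 ineq alpha_lt1.
have ab_ge : 1 <= r * (p^-1 + q^-1).
  have [[_ _ /ltW zs _] _] := ineq.
  by rewrite -(mulfV (lt0r_neq0 r_gt0)) ler_pM2l.
have v_ge0 : 0 <= q^-1 + Num.min p^-1 r^-1 - r^-1.
  by have [[_ _ zs _] _] := ineq; case: (leP p^-1 r^-1) => _; lra.
have [N1 N10 [dcurve2 bdd_large]] := bounded_large gamma_C2 gamma_mono gamma_lim0 c10 bounds
  alpha_lt1 a0 b0 r_gt0 w0 w_ge wa wb wz ab_ge eps0 epsA omegaA large v_ge0.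
have [d d0 bdd_small] := bounded_small gamma_C2 dgamma_lim0 c10 bounds alpha_lt1 a0 b0 r_gt0
  w0 w_ge wa wb wz ab_ge B1 eps0 omegaB small.
have [|t0 t00 cross] := dcurve_cross gamma_C2 gamma_mono gamma_lim0 dgamma_lim0 c10 c20 bounds.
  by exists N1 => //; have := dcurve2 _ (lexx N1); lra.
(* The half-line is ]0, del], [N, +oo[ and the part of [del, N] on the left of t0, at t0
   and on the right of t0. *)
pose del := Num.min (d / 2) t0; pose N := Num.max N1 t0.
have del0 : 0 < del by rewrite lt_min t00 divr_gt0.
have deld : del < d by rewrite gt_min; apply/orP; left; lra.
have delt0 : del <= t0 by rewrite ge_min lexx orbT.
have N1N : N1 <= N by rewrite le_max lexx.
have t0N : t0 <= N by rewrite le_max lexx orbT.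
have [k0 k00 transverse] := cross _ _ del0 delt0 t0N.
have bdd_mid sg (sgE : sg = 1 \/ sg = -1) := bounded_middle gamma_C2 gamma_mono gamma_lim0
  c10 C0 bounds alpha_lt1 a0 b0 r_gt0 w0 w_ge wa wb wz ab_ge sgE del0 delt0 t0N k00 transverse mid.
have [mR bR] := bdd_mid 1 (or_introl (erefl _)).
have [mL bL] := bdd_mid (-1) (or_intror (erefl _)).
have mgam := measurable_curve0 gamma_C2.
have mw := measurable_weight alpha; have w_ge0 := weight_ge0 alpha.
apply: (operator_bound mgam p_gt0 q_gt0 r_gt0).
set P := [set t | _] in mR bR; set M := [set t | _] in mL bL.
have mS : measurable `]0, del]%classic by exact: measurable_itv.
have mO : measurable `[N, +oo[%classic by exact: measurable_itv.
have m1 : measurable [set t0] by exact: measurable_set1.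
rewrite (_ : [set` `]0, +oo[%R] =
    `]0, del]%classic `|` (P `|` (M `|` ([set t0] `|` `[N, +oo[%classic)))).
  have BU := bounded_onU mgam mw w_ge0 r_gt0.
  have m2 := measurableU _ _ m1 mO; have m3 := measurableU _ _ mL m2.
  have bS : bounded_on (curve0 gamma) (weight alpha) p^-1 q^-1 r `]0, del]%classic.
    exact: bdd_small.
  have bO : bounded_on (curve0 gamma) (weight alpha) p^-1 q^-1 r `[N, +oo[%classic.
    exact: bdd_large.
  have b1 := bounded_on_set1 gamma_C2 alpha p^-1 q^-1 r_gt0 t0.
  have b2 := BU _ _ _ _ m1 mO b1 bO; have b3 := BU _ _ _ _ mL m2 bL b2.
  exact: BU mS (measurableU _ _ mR m3) bS (BU _ _ _ _ mR m3 bR b3).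
apply/seteqP; split => t.
  rewrite /= !in_itv/= andbT => t_gt0.
  have [td|dt] := leP t del; first by left; rewrite t_gt0.
  have [Nt|tN] := leP N t; first by right; right; right; right; rewrite ?in_itv/= ?Nt.
  have dtN : del <= t <= N by rewrite !ltW.
  case: (ltgtP t t0) => [tt|tt|->].
  - by right; right; left; split=> //; lra.
  - by right; left; split=> //; lra.
  - by right; right; right; left.
move=> [|[|[|[|]]]] /=; rewrite ?in_itv/= ?andbT.
- by move=> /andP[].
- by move=> [/andP[? ?] _]; lra.
- by move=> [/andP[? ?] _]; lra.
- by move=> ->.
- by move=> ?; lra.
Qed.
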